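(* Let $k$ be a field, $n\ge 3$, $d\ge 2$, $R=k[X_1,\dots,X_n]$ with the standard grading, $\mathfrak m=(X_1,\dots,X_n)$, and let $I=(f_0,\dots,f_n)\subset R$ be generated by $k$-linearly independent forms $f_0,\dots,f_n$ of the same degree $d$, with $\dim k[f_0,\dots,f_n]=\dim R$. Suppose $\dim(R/I)\le 1$ and $\nu(I_{\mathfrak p})\le \dim R_{\mathfrak p}+1$ for every prime ideal $\mathfrak p\supset I$. Then $$\mu_0(I)\ge\left\lfloor\frac{(n-2)(d-1)-1}{2}\right\rfloor.$$
   Context: $\nu(\cdot)$ denotes the minimal number of generators. $H_i$ denotes the $i$-th homology module of the graded Koszul complex $K_\bullet(f_0,\dots,f_n;R)$ (with degree-preserving differentials, so $K_i\simeq R(-id)^{\binom{n+1}{i}}$). For a graded module $M$, $\mathrm{indeg}(M)=\inf\{\mu : M_\mu\ne 0\}$, with $\mathrm{indeg}(0)=+\infty$. The threshold degree of $I$ is $$\mu_0(I)=(n-1)(d-1)-\min\{\mathrm{indeg}(H_1),\ \mathrm{indeg}(H^0_{\mathfrak m}(H_1))-d\}.$$ *)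

(* Defs.v *)
From HB Require Import structures.
From mathcomp Require Import all_boot all_order all_algebra.
(* [mpoly] has to be imported before [constructive_ereal]: in the other order
   the levels of their notations clash. *)
From mathcomp Require Import mpoly.
From mathcomp Require Import boolp classical_sets constructive_ereal.

Set Implicit Arguments.
Unset Strict Implicit.
Unset Printing Implicit Defensive.

Import Order.TTheory GRing.Theory Num.Theory.

Local Open Scope classical_set_scope.
Local Open Scope ring_scope.

(* Sup and inf are taken in [\bar int]: sup set0 = -oo, inf set0 = +oo. *)
Definition zsup (A : set int) : \bar int :=
  supremum -oo%E [set m%:E | m in A].

Definition zinf (A : set int) : \bar int :=
  infimum +oo%E [set m%:E | m in A].

(* Rings are given as quotients S / J, where S is a subring of an ambient ring
   A and J is an ideal of S. An ideal of S / J is represented by its preimage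
   in S, i.e. by an ideal of S containing J. *)
Section Rings.
Context {A : comNzRingType}.
Implicit Types (S J P G M : set A).

Definition is_ideal S J : Prop :=
  [/\ J `<=` S, J 0,
      forall x y, J x -> J y -> J (x + y) &
      forall a x, S a -> J x -> J (a * x)].

Definition is_prime S P : Prop :=
  [/\ is_ideal S P, ~ P 1 &
      forall a b, S a -> S b -> P (a * b) -> P a \/ P b].

Definition prime_chain S J (m : nat) (Q : nat -> set A) : Prop :=
  (forall i, (i <= m)%N -> is_prime S (Q i) /\ J `<=` Q i) /\
  (forall i, (i < m)%N -> Q i `<` Q i.+1).

Definition krull_dim S J : \bar int :=
  zsup [set m%:Z | m in [set m | exists Q, prime_chain S J m Q]].

Definition span S G : set A :=
  [set x | exists (m : nat) (c g : 'I_m -> A),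
     [/\ forall i, S (c i), forall i, G (g i) & x = \sum_(i < m) c i * g i]].

Definition ideal_gen G : set A := span setT G.

Definition ideal_pow J (t : nat) : set A :=
  ideal_gen [set x | exists2 g : 'I_t -> A,
                       forall i, J (g i) & x = \prod_(i < t) g i].

(* Minimal number of generators of M as an S-module. *)
Definition nu S M : \bar int :=
  zinf [set m%:Z | m in [set m | exists g : 'I_m -> A, M = span S (range g)]].

End Rings.

(* Localisation at P of the ideal M (of the ring itself if M = setT), as a
   subset of the fraction field. *)
Definition loc {D : idomainType} (P M : set D) : set {fraction D} :=
  [set tofrac x / tofrac s | x in M & s in ~` P].

(* The graded module N / B, where B `<=` N are submodules of V and
   [gdeg mu] is the degree mu part of V. *)
Record gsubquot (A : comNzRingType) (V : lmodType A) := GSubquot {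
  gdeg : int -> set V;
  gnum : set V;
  gden : set V
}.

Definition indeg (A : comNzRingType) (V : lmodType A) (M : gsubquot V)
    : \bar int :=
  zinf [set mu | exists z, [/\ gdeg M mu z, gnum M z & ~ gden M z]].

(* H^0_J(M), the elements of M killed by some power of J. *)
Definition local_coh0 (A : comNzRingType) (V : lmodType A) (J : set A)
    (M : gsubquot V) : gsubquot V :=
  GSubquot (gdeg M)
    [set z | gnum M z /\
       exists t : nat, forall a, ideal_pow J t a -> gden M (a *: z)]
    (gden M).

Section Koszul.
Variables (k : fieldType) (n r d : nat) (f : r.-tuple {mpoly k[n]}).

Definition homog_part (j : int) : set {mpoly k[n]} :=
  if j is Posz e then [set x | x \is e.-homog] else [set 0].

(* The exterior algebra of R^r, R = {mpoly k[n]}: [u T] is the coefficient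
   of u on the basis element e_T = e_{t_1} /\ ... /\ e_{t_p}, where
   T = {t_1 < ... < t_p}. *)
Definition koszul : lmodType {mpoly k[n]} :=
  {ffun {set 'I_r} -> {mpoly k[n]}^o}.

Definition koszul_term (p : nat) : set koszul :=
  [set u : koszul | forall T : {set 'I_r}, #|T| != p -> u T = 0].

(* d(e_{t_1} /\ ... /\ e_{t_p})
     = \sum_j (-1)^(j-1) f_{t_j} e_{t_1} /\ .. (omit e_{t_j}) .. /\ e_{t_p} *)
Definition koszul_diff (u : koszul) : koszul :=
  [ffun T : {set 'I_r} =>
     \sum_(j | j \notin T)
       (-1) ^+ #|[set i in T | (i < j)%N]| * tnth f j * u (j |: T)%SET].

(* The degree shift K_p = R(-pd)^binomial(r, p). *)
Definition koszul_deg (p : nat) (mu : int) : set koszul :=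
  [set u : koszul | koszul_term p u /\
     forall T, homog_part (mu - (p * d)%:Z) (u T)].

Definition koszul_homology (p : nat) : gsubquot koszul :=
  GSubquot (koszul_deg p)
    [set u | koszul_term p u /\ koszul_diff u = 0]
    (koszul_diff @` koszul_term p.+1).

End Koszul.

Definition max_ideal {k : fieldType} {n : nat} : set {mpoly k[n]} :=
  ideal_gen (range (fun i : 'I_n => 'X_i)).

Definition forms_ideal (k : fieldType) (n r : nat)
    (f : r.-tuple {mpoly k[n]}) : set {mpoly k[n]} :=
  ideal_gen (range (tnth f)).

(* k[f_0, ..., f_(r-1)] *)
Definition subalgebra_gen (k : fieldType) (n r : nat)
    (f : r.-tuple {mpoly k[n]}) : set {mpoly k[n]} :=
  range (fun p : {mpoly k[r]} => p \mPo f).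

Definition mu0 (k : fieldType) (n d : nat) (f : n.+1.-tuple {mpoly k[n]})
    : \bar int :=
  let H1 := koszul_homology d f 1 in
  (((n%:Z - 1) * (d%:Z - 1))%:E
   - mine (indeg H1) (indeg (local_coh0 max_ideal H1) - d%:Z%:E))%E.

(* Main.v *)
(* Write I = (f_0, ..., f_n), delta = (n-2)(d-1), e = floor(delta/2), and
   count degrees of elements of H_1 by the degree of their coefficients. If
   H_1 vanishes in degrees <= e, then f_0, ..., f_n behave like a regular
   sequence up to degree e + d, so the first difference of the Hilbert
   function of R/I at e + d is C(e+d) - 2C(e) + C(e-d) < 0, where C(j) is the
   (symmetric, unimodal) coefficient of t^j in (1 + t + ... + t^(d-1))^(n-1).
   Hence multiplication by any linear form l has a kernel on (R/I)_(e+d-1).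
   After a finite extension of the field and a change of coordinates, dim R/I
   <= 1 allows one to take l = X_1 with R/(I + (X_1)) of finite length; the
   kernel then lies in H^0_m(R/I). Local duality H^0_m(H_1) = H^0_m(R/I)^*
   turns it into a non-zero element of H^0_m(H_1) of degree (n-1)(d-1) - e <=
   e + d. The duality is made explicit: the powers (X_1^t, X_2^s, ..., X_n^s)
   define a monomial Gorenstein quotient G of R, an element of the annihilator
   of I in G is a top Koszul cycle over G, and the connecting maps lower it to
   a cycle of K_1 over R. *)
Require Import Defs.
From HB Require Import structures.
From mathcomp Require Import all_boot all_order all_algebra.
From mathcomp Require Import mpoly ring zify all_field.
From mathcomp Require Import boolp classical_sets constructive_ereal.

Set Implicit Arguments.
Unset Strict Implicit.
Unset Printing Implicit Defensive.

Import Order.TTheory GRing.Theory Num.Theory.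

Local Open Scope classical_set_scope.
Local Open Scope ring_scope.

(** The delicate point is that the class survives all the connecting maps. Let x be the element of
    R/I killed by X_1. Non-triviality is carried along in the form that x times the cycle is not a
    boundary. The powers X_j^s with j > 1 are chosen inside I + (X_1^t): modulo X_1^t they kill
    Koszul homology, which makes the complex exact over the intermediate quotients wherever the
    induction needs it. The last connecting map divides by X_1^t, which is not known to kill H_2;
    there x takes over, since x X_1^t lies in I.

    Vanishing statements, rather than classes, cross the change of field: a cycle over the extension
    is read coordinatewise over k. The extension supplies enough scalars to avoid the roots of
    finitely many determinants when k is finite. The bound on the dimension enters through one
    polynomial relation for each pair of variables. *)

(** * The Koszul differential and exterior multiplication *)

Lemma sign_absorb (A : comNzRingType) (a b c : A) :
  a * a = 1 -> a * b * (a * c) = b * c.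
Proof. by move=> aa; rewrite mulrACA aa mul1r. Qed.

(* The operations are sealed: unification would otherwise unfold the finite
   functions behind [koszul]. *)
HB.lock Definition kdiff (K : fieldType) (n r : nat)
  (f : r.-tuple {mpoly K[n]}) (u : koszul K n r) : koszul K n r :=
  koszul_diff f u.

HB.lock Definition kscale (K : fieldType) (n r : nat) (a : {mpoly K[n]})
  (u : koszul K n r) : koszul K n r := a *: u.

Definition ksign (K : fieldType) (n r : nat) (T : {set 'I_r}) (j : 'I_r) :
  {mpoly K[n]} := (-1) ^+ #|[set i in T | (i < j)%N]|.

HB.lock Definition wedge (K : fieldType) (n r : nat) (i : 'I_r)
  (u : koszul K n r) : koszul K n r :=
  [ffun T : {set 'I_r} => if i \in T then ksign K n T i * u (T :\ i)%SET
                          else (0 : {mpoly K[n]})].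

Section KoszulAlgebra.
Variables (K : fieldType) (n r : nat) (f : r.-tuple {mpoly K[n]}).
Local Notation R := {mpoly K[n]}.
Local Notation kos := (koszul K n r).
Local Notation term := (@koszul_term K n r).
Local Notation dd := (kdiff f).
Implicit Types (u v w : kos) (T : {set 'I_r}).

Local Notation ksign := (ksign K n).

Lemma ksign_sqr T j : ksign T j * ksign T j = 1.
Proof. by rewrite /ksign -expr2 sqrr_sign. Qed.

Lemma ksignU T (i j : 'I_r) : i \notin T ->
  ksign (i |: T)%SET j = ksign T j * (-1) ^+ (i < j)%N.
Proof.
move=> iT; rewrite /ksign -exprD; congr (_ ^+ _).
case: ltnP => ij /=.
  have -> : [set x in (i |: T)%SET | (x < j)%N] =
            (i |: [set x in T | (x < j)%N])%SET.
    by apply/setP => x; rewrite !inE; case: eqP => [->|//]; rewrite ij.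
  by rewrite cardsU1 inE (negPf iT) /= addnC.
rewrite addn0; congr (#|pred_of_set _|); apply/setP => x; rewrite !inE.
by case: eqP => [->|//]; rewrite ltnNge ij /= !andbF.
Qed.

Lemma kos_ext u v : (forall T, u T = v T :> R) -> u = v.
Proof. by move=> uv; apply/ffunP => T; apply: uv. Qed.

Lemma kaddE u v T : (u + v) T = u T + v T :> R.
Proof. by rewrite ffunE. Qed.

Lemma koppE u T : (- u) T = - (u T) :> R.
Proof. by rewrite ffunE. Qed.

Lemma kzeroE T : (0 : kos) T = 0 :> R.
Proof. by rewrite ffunE. Qed.

Local Notation "a *' u" := (kscale a u) (at level 40).

Lemma kscaleE a u T : (a *' u) T = a * u T :> R.
Proof. by rewrite kscale.unlock ffunE. Qed.

Lemma kdE u T : dd u T =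
  \sum_(j | j \notin T) ksign T j * tnth f j * u (j |: T)%SET :> R.
Proof. by rewrite kdiff.unlock ffunE. Qed.

Lemma kdD u v : dd (u + v) = dd u + dd v.
Proof.
apply: kos_ext => T; rewrite kaddE !kdE -big_split /=; apply: eq_bigr => j _.
by rewrite kaddE mulrDr.
Qed.

Lemma kd_scale a u : dd (a *' u) = a *' dd u.
Proof.
apply: kos_ext => T; rewrite kscaleE !kdE mulr_sumr; apply: eq_bigr => j _.
by rewrite kscaleE mulrCA.
Qed.

Lemma kd0 : dd 0 = 0.
Proof.
by apply: kos_ext => T; rewrite kdE kzeroE big1 // => j _; rewrite kzeroE mulr0.
Qed.

Lemma kdB u v : dd (u - v) = dd u - dd v.
Proof. by apply/eqP; rewrite eq_sym subr_eq -kdD subrK. Qed.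

Lemma kscaleA a b u : a *' (b *' u) = (a * b) *' u.
Proof. by apply: kos_ext => T; rewrite !kscaleE mulrA. Qed.

Lemma kscaleDl a b u : (a + b) *' u = a *' u + b *' u.
Proof. by apply: kos_ext => T; rewrite kaddE !kscaleE mulrDl. Qed.

Lemma kscaleBr a u v : a *' (u - v) = a *' u - a *' v.
Proof. by apply: kos_ext => T; rewrite !(kscaleE, kaddE, koppE) mulrBr. Qed.

Lemma kscale0r u : 0 *' u = 0.
Proof. by apply: kos_ext => T; rewrite kscaleE kzeroE mul0r. Qed.

Lemma kdK u : dd (dd u) = 0.
Proof.
apply: kos_ext => T; rewrite kdE kzeroE.
pose F (j l : 'I_r) : R := ksign T j * tnth f j *
  (ksign (j |: T)%SET l * tnth f l * u (l |: (j |: T))%SET).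
have F_anti j l : j \notin T -> l \notin T -> (j < l)%N -> F j l + F l j = 0.
  move=> jT lT jl; rewrite /F finset.setUCA !ksignU // jl ltnNge ltnW //= expr1
    expr0.
  set z := u _; ring.
transitivity (\sum_(j | j \notin T)
   \sum_(l | (l \notin T) && (l != j)) F j l).
  apply: eq_bigr => j jT; rewrite kdE mulr_sumr; apply: eq_bigl => l.
  by rewrite !inE negb_or andbC.
(* The double sum splits by which of the two indices is smaller; after an exchange of sums the
   halves cancel termwise by [F_anti]. *)
pose P (j l : 'I_r) := [&& j \notin T, l \notin T & (j < l)%N].
transitivity (\sum_j \sum_(l | P j l) F j l + \sum_j \sum_(l | P l j) F j l).
  rewrite -big_split /= [in LHS]big_mkcond /=; apply: eq_bigr => j _.
  case: ifPn => [jT|/negPn jT]; last first.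
    rewrite !big_pred0 ?addr0 // => l; rewrite /P jT //= andbF //.
  by rewrite (bigID (fun l : 'I_r => (j < l)%N)) /=; congr (_ + _);
    apply: eq_bigl => l; rewrite /P jT /= -(inj_eq val_inj) /=;
    case: ltngtP; rewrite ?andbF ?andbT.
rewrite [X in _ + X](exchange_big_dep xpredT) //= -big_split /=.
apply: big1 => j _; rewrite -big_split /=; apply: big1 => l /and3P[jT lT jl].
exact: F_anti.
Qed.

Lemma wedgeE i u T :
  wedge i u T = (if i \in T then ksign T i * u (T :\ i)%SET else 0) :> R.
Proof. by rewrite wedge.unlock ffunE. Qed.

(** The differential is an antiderivation, so exterior multiplication by e_i is a null-homotopy of
    multiplication by f_i. *)
Lemma kd_wedge i u : dd (wedge i u) = tnth f i *' u - wedge i (dd u).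
Proof.
apply: kos_ext => T; rewrite kdE kaddE koppE kscaleE wedgeE kdE.
case: ifPn => [iT|iT]; last first.
  rewrite subr0 (bigD1 i) //= big1 ?addr0 => [|j /andP[jT ji]]; last first.
    by rewrite wedgeE !inE eq_sym (negPf ji) (negPf iT) mulr0.
  rewrite wedgeE finset.setU11 finset.setU1K // ksignU // ltnn mulr1.
  exact/sign_absorb/ksign_sqr.
rewrite [X in _ = _ - _ * X](bigD1 i) ?inE ?eqxx //= finset.setD1K //.
have -> : ksign (T :\ i) i = ksign T i.
  by rewrite -[in RHS](finset.setD1K iT) ksignU ?inE ?eqxx // ltnn mulr1.
rewrite mulrDr !mulrA ksign_sqr mul1r opprD addrA subrr add0r mulr_sumr -sumrN.
apply: eq_big => [j|j jT].
  by rewrite !inE negb_and negbK; case: eqP => [->|]; rewrite ?iT ?andbT ?andbF.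
have ji : j != i by apply: contraNneq jT => ->.
rewrite wedgeE !inE iT orbT.
have -> : ((j |: T) :\ i)%SET = (j |: (T :\ i))%SET.
  apply/setP => x; rewrite !inE; case: (x =P i) => [->|] /=.
    by rewrite eq_sym (negPf ji).
  by [].
rewrite ksignU // -[in ksign T j](finset.setD1K iT) ksignU ?inE ?eqxx //.
have -> : ((-1) ^+ (j < i)%N : R) = - (-1) ^+ (i < j)%N.
  by rewrite -(inj_eq val_inj) /= in ji; case: ltngtP ji; rewrite ?expr1 ?opprK.
have := signrMK (i < j)%N (1 : R); rewrite mulr1.
set a := (_ ^+ _); set b := u _ => aa.
transitivity (- (a * a) * (ksign (T :\ i) j * tnth f j * ksign T i * b));
  first by ring.
by rewrite aa; ring.
Qed.

Lemma kterm0 p : term p 0.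
Proof. by move=> T _; rewrite kzeroE. Qed.

Lemma ktermD p u v : term p u -> term p v -> term p (u + v).
Proof. by move=> hu hv T hT; rewrite kaddE hu // hv // addr0. Qed.

Lemma ktermZ p a u : term p u -> term p (a *' u).
Proof. by move=> hu T hT; rewrite kscaleE hu // mulr0. Qed.

Lemma ktermN p u : term p u -> term p (- u).
Proof. by move=> hu T hT; rewrite koppE hu // oppr0. Qed.

Lemma ktermB p u v : term p u -> term p v -> term p (u - v).
Proof. by move=> hu hv; apply: ktermD => //; apply: ktermN. Qed.

Lemma kterm_d p u : term p.+1 u -> term p (dd u).
Proof.
move=> hu T hT; rewrite kdE big1 // => j jT.
by rewrite hu ?mulr0 // cardsU1 jT.
Qed.

Lemma kterm_wedge p i u : term p u -> term p.+1 (wedge i u).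
Proof.
move=> hu T hT; rewrite wedgeE; case: ifP => // iT; rewrite hu ?mulr0 //.
by apply: contra hT => /eqP <-; rewrite (cardsD1 i T) iT.
Qed.

Lemma kterm_big p u : (r < p)%N -> term p u -> u = 0.
Proof.
move=> rp hu; apply: kos_ext => T; rewrite kzeroE hu //.
rewrite neq_ltn (leq_ltn_trans _ rp) //.
by rewrite -[X in (_ <= X)%N]card_ord max_card.
Qed.

End KoszulAlgebra.

(** * Koszul cycles modulo an ideal *)

Section Ideals.
Variables (A : comNzRingType) (J : set A).
Hypothesis J_ideal : is_ideal setT J.

Lemma ideal0 : J 0. Proof. by case: J_ideal. Qed.

Lemma idealD a b : J a -> J b -> J (a + b).
Proof. by case: J_ideal => _ _ + _; apply. Qed.

Lemma ideal_mull a b : J b -> J (a * b).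
Proof. by case: J_ideal => _ _ _; apply. Qed.

Lemma ideal_mulr a b : J a -> J (a * b).
Proof. by rewrite mulrC; apply: ideal_mull. Qed.

Lemma idealN a : J a -> J (- a).
Proof. by rewrite -mulN1r; apply: ideal_mull. Qed.

Lemma ideal_sum (I : Type) (s : seq I) (P : pred I) (F : I -> A) :
  (forall i, P i -> J (F i)) -> J (\sum_(i <- s | P i) F i).
Proof. by move=> JF; elim/big_ind: _ => //; [apply: ideal0|apply: idealD]. Qed.

End Ideals.

Section AddIdeal.
Variable A : comNzRingType.
Implicit Types (J : set A) (y a b : A).

Definition ideal_add J y : set A :=
  [set a | exists b c, J b /\ a = b + y * c].

Lemma ideal_add_ideal J y : is_ideal setT J -> is_ideal setT (ideal_add J y).
Proof.
move=> JI; split=> //.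
- by exists 0, 0; rewrite mulr0 addr0; split=> //; apply: ideal0.
- move=> _ _ [b [c [Jb ->]]] [b' [c' [Jb' ->]]]; exists (b + b'), (c + c').
  by split; [apply: idealD | rewrite mulrDr addrACA].
- move=> a _ _ [b [c [Jb ->]]]; exists (a * b), (a * c).
  by split; [apply: ideal_mull | rewrite mulrDr mulrCA].
Qed.

Lemma sub_ideal_add J y : J `<=` ideal_add J y.
Proof. by move=> a Ja; exists a, 0; rewrite mulr0 addr0. Qed.

Lemma zero_ideal : is_ideal setT [set 0 : A].
Proof.
split=> // [x y -> ->|a x _ ->]; first exact: addr0.
exact: mulr0.
Qed.

Definition regular_mod J y := forall a, J (y * a) -> J a.

End AddIdeal.

Section Homog.
Variables (K : fieldType) (n : nat).

Lemma ksign_homog r (T : {set 'I_r}) j : ksign K n T j \is 0.-homog.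
Proof.
rewrite /ksign -signr_odd.
by case: odd; rewrite ?expr0 ?expr1 ?rpredN dhomog1.
Qed.

Implicit Types (p q : {mpoly K[n]}) (J : set {mpoly K[n]}).

Lemma pihomogM s b p q : p \is s.-homog ->
  pihomog mdeg (s + b) (p * q) = p * pihomog mdeg b q.
Proof.
move=> hp; pose k := maxn (mmeasure mdeg q) b.+1.
have qk : (mmeasure mdeg q <= k)%N by rewrite leq_maxl.
have bk : (b < k)%N by rewrite leq_maxr.
rewrite [in LHS](pihomog_partitionE qk) mulr_sumr raddf_sum /=.
rewrite (bigD1 (Ordinal bk)) //= big1 ?addr0 => [|i ib]; last first.
  apply: (@pihomog_ne0 _ _ _ (s + i)); first by rewrite eqn_add2l;
    apply: contra ib => /eqP ib; apply/eqP/val_inj.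
  exact/dhomogM/pihomogP.
by rewrite pihomog_dE //; apply/dhomogM/pihomogP.
Qed.

Lemma pihomogM_lt s b p q : p \is s.-homog -> (b < s)%N ->
  pihomog mdeg b (p * q) = 0.
Proof.
move=> hp bs; rewrite (pihomog_partitionE (leqnn (mmeasure mdeg q))).
rewrite mulr_sumr raddf_sum big1 //= => i _.
apply: (@pihomog_ne0 _ _ _ (s + i)); last exact/dhomogM/pihomogP.
by rewrite neq_ltn (leq_trans bs) ?orbT // leq_addr.
Qed.

Definition homog_ideal J := forall b p, J p -> J (pihomog mdeg b p).

Lemma homog_ideal0 : homog_ideal [set 0].
Proof. by move=> b p ->; exact: pihomog0. Qed.

Lemma homog_ideal_add J s y : homog_ideal J -> y \is s.-homog ->
  is_ideal setT J -> homog_ideal (ideal_add J y).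
Proof.
move=> hJ hy JI b _ [p [q [Jp ->]]]; rewrite raddfD /=.
have [bs|sb] := ltnP b s.
  by exists (pihomog mdeg b p), 0; rewrite (pihomogM_lt _ hy bs) mulr0;
    split=> //; apply: hJ.
exists (pihomog mdeg b p), (pihomog mdeg (b - s) q); split; [exact: hJ|].
by rewrite -(pihomogM _ _ hy) subnKC.
Qed.

End Homog.

Section Chase.
Variables (K : fieldType) (n r d : nat) (f : r.-tuple {mpoly K[n]}).
Local Notation R := {mpoly K[n]}.
Local Notation kos := (koszul K n r).
Local Notation term := (@koszul_term K n r).
Local Notation dd := (kdiff f).
Local Notation "a *' u" := (kscale a u) (at level 40).
Implicit Types (u v w : kos) (T : {set 'I_r}) (J : set R) (x y a : R).

Definition kmod J u := forall T, J (u T).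
Definition khom (e : nat) u := forall T, (u T : R) \is e.-homog.

(** Exactness at spot [p] of the Koszul complex over R/J, phrased with lifts to R so that no
    quotient ring has to be formed. *)
Definition kexact J p := forall u, term p u -> kmod J (dd u) ->
  exists2 v, term p.+1 v & kmod J (u - dd v).

Section Mod.
Variable J : set R.
Hypothesis JI : is_ideal setT J.

Lemma kmodD u v : kmod J u -> kmod J v -> kmod J (u + v).
Proof. by move=> hu hv T; rewrite kaddE; apply: idealD. Qed.

Lemma kmodZ a u : kmod J u -> kmod J (a *' u).
Proof. by move=> hu T; rewrite kscaleE; apply: ideal_mull. Qed.

Lemma kmodZl a u : J a -> kmod J (a *' u).
Proof. by move=> hu T; rewrite kscaleE; apply: ideal_mulr. Qed.

Lemma kmodN u : kmod J u -> kmod J (- u).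
Proof. by move=> hu T; rewrite koppE; apply: idealN. Qed.

Lemma kmod0 : kmod J 0.
Proof. by move=> T; rewrite kzeroE; apply: ideal0. Qed.

Lemma kmod_d u : kmod J u -> kmod J (dd u).
Proof. by move=> hu T; rewrite kdE; apply: ideal_sum => // i _;
  apply: ideal_mull. Qed.

Lemma kmod_wedge i u : kmod J u -> kmod J (wedge i u).
Proof.
move=> hu T; rewrite wedgeE; case: ifP => _; last exact: ideal0.
exact: ideal_mull.
Qed.

Lemma kmod_split p y u : term p u -> kmod (ideal_add J y) u ->
  exists u1 u2, [/\ term p u2, kmod J u1 & u = u1 + y *' u2].
Proof.
move=> tu hu.
(* The cofactor of [y] is not unique; requiring it to vanish off cardinality [p] keeps [u2] in
   exterior degree [p]. *)
have /choice[g hg] T : exists c : R, J (u T - y * c) /\ (#|T| != p -> c = 0).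
  have [Tp|Tp] := eqVneq #|T| p; last first.
    by exists 0; rewrite tu // mulr0 subr0; split=> //; apply: ideal0.
  by have [b [c [Jb ->]]] := hu T; exists c; rewrite addrK.
pose u2 : kos := [ffun T => g T]; exists (u - y *' u2), u2; split.
- by move=> T hT; rewrite ffunE; apply: (hg T).2.
- by move=> T; rewrite kaddE koppE kscaleE ffunE; apply: (hg T).1.
- by rewrite subrK.
Qed.

(* Multiplication by [f_i] is homotopic to zero on the Koszul complex. *)
Lemma forms_kill_homology a p u : ideal_gen (range (tnth f)) a ->
  term p u -> kmod J (dd u) ->
  exists2 v, term p.+1 v & kmod J (a *' u - dd v).
Proof.
move=> [m [c [g [_ gf ->]]]] tu du.
elim: m c g gf => [|m IH] c g gf.
  by exists 0; [apply: kterm0 | rewrite big_ord0 kscale0r kd0 subr0;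
    apply: kmod0].
have [v tv hv] := IH (fun i => c (widen_ord (leqnSn m) i))
  (fun i => g (widen_ord (leqnSn m) i)) (fun i => gf _).
have [i _ gi] := gf ord_max.
exists (v + c ord_max *' wedge i u).
  by apply: ktermD => //; apply/ktermZ/kterm_wedge.
rewrite big_ord_recr /= -gi kscaleDl kdD kd_scale kd_wedge.
rewrite kscaleBr kscaleA opprD addrACA; apply: kmodD; [exact: hv|].
rewrite opprB addrC subrK.
by apply: kmodZ; apply: kmod_wedge.
Qed.

Lemma kexact_big p : (r < p)%N -> kexact J p.
Proof.
move=> rp u tu _; exists 0; first exact: kterm0.
by rewrite (kterm_big rp tu) kd0 subr0; apply: kmod0.
Qed.

(** From the long exact sequence of multiplication by [y] on R/J: vanishing of H_(p+1) over R/(J +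
    y) makes [y] injective on H_p over R/J. A map that is both injective and zero has zero
    source. *)
Lemma kexact_descend p y : regular_mod J y -> kexact (ideal_add J y) p.+1 ->
  (forall u, term p u -> kmod J (dd u) ->
     exists2 v, term p.+1 v & kmod J (y *' u - dd v)) ->
  kexact J p.
Proof.
move=> yreg ex kill u tu du.
have [v tv hv] := kill u tu du.
have dv : kmod (ideal_add J y) (dd v).
  move=> T; have := hv T; rewrite kaddE koppE kscaleE => hT.
  exists (- (y * u T - dd v T)), (u T); split; first exact: idealN.
  by rewrite opprB subrK.
have [w tw hw] := ex v tv dv.
have [|u1 [u2 [tu2 hu1 def]]] := kmod_split (p := p.+1) _ hw.
  by apply: ktermB => //; apply: kterm_d.
exists u2 => // T; apply: yreg.
have {}def : dd v = dd u1 + y *' dd u2.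
  by rewrite -kd_scale -kdD -def kdB kdK subr0.
have := kmodD hv (kmod_d hu1); rewrite def opprD addrA addrAC subrK.
by rewrite -kscaleBr => h; have := h T; rewrite kscaleE.
Qed.

(* The connecting map of multiplication by [y] on [R/J]. *)
Lemma snake_step p s e y u : homog_ideal J -> regular_mod J y ->
  y \is s.-homog -> (forall i, tnth f i \is d.-homog) -> (s <= e + d)%N ->
  term p.+1 u -> khom e u -> kmod (ideal_add J y) (dd u) ->
  exists v, [/\ term p v, khom (e + d - s) v, kmod J (dd v)
              & kmod J (dd u - y *' v)].
Proof.
move=> hJ yreg hy hf sa tu hu du.
have [|u1 [u2 [tu2 hu1 def]]] := kmod_split (p := p) _ du; first exact: kterm_d.
(* The cofactor [u2] need not be homogeneous; as J is a homogeneous ideal, its component of the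
   expected degree is again a cofactor of [y] modulo J. *)
pose v : kos := [ffun T => pihomog mdeg (e + d - s) (u2 T)].
have vE T : v T = pihomog mdeg (e + d - s) (u2 T) :> R by rewrite ffunE.
have key : kmod J (dd u - y *' v).
  move=> T; rewrite kaddE koppE kscaleE vE -(pihomogM _ _ hy) subnKC //.
  have -> : dd u T = pihomog mdeg (e + d) (dd u T : R).
    rewrite pihomog_dE // kdE; apply: rpred_sum => j _.
    rewrite addnC; apply: dhomogM; last exact: hu.
    rewrite -[d]add0n; apply: dhomogM; last exact: hf.
    exact: ksign_homog.
  rewrite -raddfB /=; apply: hJ.
  by move: def => /(congr1 (fun w : kos => w T)); rewrite kaddE kscaleE => ->;
    rewrite addrK.
exists v; split=> //.
- by move=> T hT; rewrite vE tu2 // raddf0.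
- by move=> T; rewrite vE; apply: pihomogP.
- move=> T; apply: yreg; rewrite -kscaleE.
  have := kmod_d key; rewrite kdB kdK sub0r kd_scale => /kmodN.
  by rewrite opprK => h; exact: h.
Qed.

End Mod.

End Chase.

(** * Connecting maps along a regular sequence *)

Section RegularSequence.
Variables (K : fieldType) (n N d : nat) (f : N.+1.-tuple {mpoly K[n]}).
Local Notation R := {mpoly K[n]}.
Local Notation kos := (koszul K n N.+1).
Local Notation term := (@koszul_term K n N.+1).
Local Notation dd := (kdiff f).
Local Notation "a *' u" := (kscale a u) (at level 40).
Variables (y : nat -> R) (s : nat -> nat).

Fixpoint seq_ideal (j : nat) : set R :=
  if j is i.+1 then ideal_add (seq_ideal i) (y i) else [set 0].

Lemma seq_ideal_ideal j : is_ideal setT (seq_ideal j).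
Proof. by elim: j => [|j IH] /=; [apply: zero_ideal | apply: ideal_add_ideal].
  Qed.
Local Hint Resolve seq_ideal_ideal : core.

Lemma seq_ideal_le i j : (i <= j)%N -> seq_ideal i `<=` seq_ideal j.
Proof.
elim: j => [|j IH]; first by rewrite leqn0 => /eqP->.
rewrite leq_eqVlt => /predU1P[->//|/IH sub] a /sub; exact: sub_ideal_add.
Qed.

Hypothesis f_homog : forall i, tnth f i \is d.-homog.
Hypothesis y_homog : forall j, y j \is (s j).-homog.
Hypothesis y_regular :
  forall j, (j < N)%N -> regular_mod (seq_ideal j) (y j).
Hypothesis y_mod : forall j, (0 < j < N)%N -> exists a b,
  [/\ ideal_gen (range (tnth f)) a, seq_ideal 1 b & y j = a + b].

Lemma seq_ideal_homog j : homog_ideal (seq_ideal j).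
Proof.
elim: j => [|j IH]; first exact: homog_ideal0.
exact: homog_ideal_add (y_homog j) _.
Qed.

(** Descending induction on [j]. For j = N the complex of N + 1 forms is zero at spot p. Below, y_j
    = a + b kills H_p modulo [seq_ideal j]: a lies in the ideal of the forms, hence is
    null-homotopic, and b is zero in the quotient because j > 0. Then [kexact_descend] applies. *)
Lemma seq_ideal_exact j p : (0 < j <= N)%N -> (j.+2 <= p)%N ->
  kexact f (seq_ideal j) p.
Proof.
move Ek: (N - j)%N => k; elim: k j p Ek => [|k IH] j p Ek /andP[j0 jN] jp.
  by apply: kexact_big => //; lia.
have jltN : (j < N)%N by lia.
apply: (kexact_descend _ (y_regular jltN)) => //.
  by rewrite -/(seq_ideal j.+1); apply: IH; lia.
move=> u tu du; have [|a [b [Ia Jb ->]]] := @y_mod j; first by rewrite j0.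
have [//|v tv hv] := forms_kill_homology _ Ia tu du.
exists v; first exact: tv.
rewrite kscaleDl.
rewrite addrAC.
apply: (kmodD (seq_ideal_ideal j)); first exact: hv.
by apply: kmodZl => //; apply: seq_ideal_le j0 _ Jb.
Qed.

Variables (x c : R) (deg : nat -> nat).
Hypothesis N_gt0 : (0 < N)%N.
Hypothesis deg_le : forall j, (j < N)%N -> (s j <= deg j.+1 + d)%N.
Hypothesis degE : forall j, (j < N)%N -> deg j = (deg j.+1 + d - s j)%N.
Hypothesis xy0 : ideal_gen (range (tnth f)) (x * y 0).
Hypothesis c_homog : c \is (deg N).-homog.
Hypothesis cf : forall i, seq_ideal N (c * tnth f i).
Hypothesis cx : ~ seq_ideal N (c * x).

(** A substitute for [seq_ideal_exact] at j = 0: the element x y_0 of the ideal kills H_2, and y_0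
    is injective on H_2 because H_3 vanishes modulo y_0. So x already kills H_2. *)
Lemma kills_H2 u : term 2 u -> dd u = 0 ->
  exists2 v, term 3 v & x *' u = dd v.
Proof.
move=> tu du.
have du0 : kmod [set 0] (dd u) by move=> T; rewrite du kzeroE.
have zI := @zero_ideal R.
have [//|v tv hv] := forms_kill_homology _ xy0 tu du0.
have {}hv : dd v = y 0 *' (x *' u).
  apply: kos_ext => T; have := hv T; rewrite kaddE koppE kscaleA mulrC => /eqP.
  by rewrite subr_eq0 => /eqP.
have [|w tw hw] := seq_ideal_exact (j := 1) (p := 3) N_gt0 isT tv.
  by move=> T; exists 0, (x * u T); rewrite add0r hv !kscaleE.
have [|u1 [u2 [tu2 hu1 def]]] := kmod_split (p := 3) zI _ hw.
  by apply: ktermB => //; apply: kterm_d.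
exists u2 => //; apply: kos_ext => T.
apply/eqP; rewrite -subr_eq0; apply/eqP.
apply: (y_regular N_gt0).
have {}def : dd v = y 0 *' dd u2.
  have -> : v = dd w + u1 + y 0 *' u2 by rewrite -addrA -def addrC subrK.
  rewrite !kdD kd_scale kdK add0r.
  have -> : u1 = 0 by apply: kos_ext => S; rewrite hu1 kzeroE.
  by rewrite kd0 add0r.
by rewrite -koppE -kaddE -kscaleE kscaleBr -def -hv subrr kzeroE.
Qed.

(** The induction starts at j = N with [c] on the top basis vector, where there are no boundaries
    and the claim is that c x is non-zero. The factor [x] is kept throughout because the final step,
    in [torsion_class], controls H_2 over R only up to multiplication by [x]. *)
Lemma snake j : (0 < j <= N)%N ->
  exists u, [/\ term j.+1 u, khom (deg j) u, kmod (seq_ideal j) (dd u) &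
    forall b, term j.+2 b -> ~ kmod (seq_ideal j) (x *' u - dd b)].
Proof.
move Ek: (N - j)%N => k; elim: k j Ek => [|k IH] j Ek /andP[j0 jN].
  have -> : j = N by lia.
  pose u : kos := [ffun T => if T == [set: 'I_N.+1]%SET then c else 0].
  have uE T : u T = (if T == [set: 'I_N.+1]%SET then c else 0) :> R
    by rewrite ffunE.
  exists u; split.
  - move=> T hT; rewrite uE; case: (T =P _) hT => // ->.
    by rewrite cardsT card_ord eqxx.
  - by move=> T; rewrite uE; case: ifP => _ //; apply: dhomog0.
  - move=> T; rewrite kdE; apply: ideal_sum => // i _.
    rewrite uE; case: ifP => _; last by rewrite mulr0; apply: ideal0.
    by rewrite -mulrA; apply: ideal_mull => //; rewrite mulrC.
  - move=> b tb; rewrite (kterm_big _ tb) // kd0 subr0 =>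
    /(_ [set: 'I_N.+1]%SET).
    by rewrite kscaleE uE eqxx mulrC.
have jltN : (j < N)%N by lia.
have [||u [tu hu du nu]] := IH j.+1; [lia|lia|].
have [v [tv hv dv huv]] := snake_step (seq_ideal_ideal j) (@seq_ideal_homog j)
  (y_regular jltN) (y_homog j) f_homog (deg_le jltN) tu hu du.
exists v; rewrite degE //; split=> // b tb hb.
have JI := seq_ideal_ideal j.
have jN' : (0 < j <= N)%N by rewrite j0.
(* If x v were the boundary of b, this element would be a cycle modulo [seq_ideal j], hence a
   boundary by exactness. That would make x u a boundary modulo [seq_ideal j.+1], against the choice
   of u. *)
have txu : term j.+2 (x *' u - y j *' b) by apply: ktermB; apply: ktermZ.
have [|b' tb' hb'] := seq_ideal_exact jN' (leqnn _) txu.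
  rewrite kdB !kd_scale.
  have -> : x *' dd u - y j *' dd b =
    x *' (dd u - y j *' v) + y j *' (x *' v - dd b).
    by rewrite !kscaleBr !kscaleA [y j * x]mulrC addrA subrK.
  by apply: (kmodD JI); apply: (kmodZ JI).
apply: (nu b') => // T; exists (x * u T - y j * b T - dd b' T), (b T).
split; last by rewrite kaddE koppE kscaleE; ring.
by have := hb' T; rewrite !kaddE !koppE !kscaleE.
Qed.

Lemma torsion_class : exists z, [/\ term 1 z, khom (deg 0) z, dd z = 0,
  exists2 w, term 2 w & y 0 *' z = dd w &
  forall b, term 2 b -> z <> dd b].
Proof.
have [|u [tu hu du nu]] := @snake 1; first exact: N_gt0.
have zI := @zero_ideal R.
have [v [tv hv dv huv]] := snake_step zI (@homog_ideal0 K n)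
  (y_regular N_gt0) (y_homog 0) f_homog (deg_le N_gt0) tu hu du.
have {}huv : dd u = y 0 *' v.
  apply: kos_ext => T; have := huv T; rewrite kaddE koppE => /eqP.
  by rewrite subr_eq0 => /eqP.
exists v; rewrite degE //; split=> //.
- by apply: kos_ext => T; rewrite kzeroE; apply: dv.
- by exists u.
move=> b tb vb.
have [||b' tb' hb'] := @kills_H2 (u - y 0 *' b).
- by apply: ktermB => //; apply: ktermZ.
- by rewrite kdB kd_scale -vb huv subrr.
apply: (nu b') => // T; exists 0, (x * b T); split=> //.
have := congr1 (fun w : kos => w T : R) hb'.
rewrite !kscaleE !kaddE !koppE !kscaleE => <-; ring.
Qed.

End RegularSequence.

(** * Monomial complete intersections *)

Section MonomialIdeals.
Variables (K : fieldType) (n : nat).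
Local Notation R := {mpoly K[n.+1]}.
Implicit Types (a b c g p x : R) (m : 'X_{1..n.+1}).
Variable s : nat -> nat.

Definition power_var (j : nat) : R := 'X_(inord j) ^+ s j.

Lemma power_varE j : power_var j = 'X_[(U_(inord j) *+ s j)%MM].
Proof. by rewrite /power_var mpolyXn. Qed.

Definition box_free (j : nat) p :=
  forall m, (forall i, (i < j)%N -> (m (inord i) < s i)%N) -> p@_m = 0.

Lemma mcoeffXM_lt (u m : 'X_{1..n.+1}) i p :
  (m i < u i)%N -> ('X_[u] * p)@_m = 0.
Proof.
move=> mu; apply/eqP; rewrite mcoeff_eq0 mulrC (perm_mem (msuppMX _ _)).
apply/mapP => -[m' _ mE]; move: mu; rewrite mE mnmDE; lia.
Qed.

Lemma mcoeffXM (u m : 'X_{1..n.+1}) p : ('X_[u] * p)@_(u + m) = p@_m.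
Proof. by rewrite mulrC mcoeffMX. Qed.

Lemma monomial_ideal_subset j p : seq_ideal power_var j p -> box_free j p.
Proof.
elim: j p => [p -> m _|j IH _ [b [c [hb ->]]] m hm]; first by rewrite mcoeff0.
rewrite mcoeffD (IH _ hb) ?add0r; last by move=> i ij; apply: hm; lia.
rewrite power_varE (mcoeffXM_lt (i := inord j)) //.
by rewrite mulmnE mnm1E eqxx mul1n hm.
Qed.

Lemma box_free_monomial_ideal j p : box_free j p -> seq_ideal power_var j p.
Proof.
elim: j p => [p hp|j IH p hp].
  by apply/mpolyP => m; rewrite hp ?mcoeff0.
pose Q m := (s j <= m (inord j))%N.
exists (\sum_(m <- msupp p | ~~ Q m) p@_m *: 'X_[m]),
       (\sum_(m <- msupp p | Q m) p@_m *: 'X_[m - U_(inord j) *+ s j]).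
split; last first.
  rewrite {1}[p]mpolyE (bigID Q) /= addrC; congr (_ + _).
  rewrite mulr_sumr; apply: eq_bigr => m Qm.
  rewrite -scalerAr power_varE -mpolyXD addmC submK //.
  apply/mnm_lepP => i; rewrite mulmnE mnm1E; case: eqP => [<-|//].
  by rewrite mul1n.
apply: IH => m hm; rewrite raddf_sum /=; apply: big1 => m' Qm'.
rewrite mcoeffZ mcoeffX; case: eqP => [mm|]; last by rewrite mulr0.
rewrite mulr1; rewrite {}mm in Qm' *; apply: hp => i.
rewrite ltnS leq_eqVlt => /predU1P[->|]; last exact: hm.
by rewrite ltnNge.
Qed.

(** On coefficients, multiplication by the power of X_j shifts only the j-th exponent, which the
    membership test for the powers of the earlier variables does not see. *)
Lemma power_var_regular j : (j <= n)%N ->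
  regular_mod (seq_ideal power_var j) (power_var j).
Proof.
move=> jn a /monomial_ideal_subset ha; apply: box_free_monomial_ideal => m hm.
rewrite -(mcoeffXM (U_(inord j) *+ s j)) -power_varE; apply: ha => i ij.
rewrite mnmDE mulmnE mnm1E.
case: eqP => [/(congr1 val)|_]; last by rewrite mul0n; apply: hm.
by rewrite /= !inordK ?ltnS //; lia.
Qed.

Lemma power_var_homog j : power_var j \is (s j).-homog.
Proof. by rewrite power_varE dhomogX /= mdegMn mdeg1 mul1n eqxx. Qed.

(** The exponent of the monomial spanning the socle of the quotient by the powers of all
    variables. *)
Definition socle_exp : 'X_{1..n.+1} := [multinom (s i).-1 | i < n.+1].

Hypothesis s_gt0 : forall i, (0 < s i)%N.

Lemma box_freeP p :
  box_free n.+1 p <-> forall m, (m <= socle_exp)%MM -> p@_m = 0.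
Proof.
split=> hp m hm; apply: hp.
  move=> i iN; have /mnm_lepP/(_ (inord i)) := hm.
  by rewrite mnmE inordK //; have := s_gt0 i; lia.
apply/mnm_lepP => i; rewrite mnmE; have := hm i (ltn_ord i).
by rewrite inord_val; lia.
Qed.

(* Macaulay's inverse system: a linear form on polynomials of degree [e]
   is the pairing against a multiplier of complementary degree, modulo the
   powers of the variables. *)
Variables (e : nat) (lam : {scalar R}).
Hypothesis s_gt : forall i, (e < s i)%N.

Definition multiplier : R :=
  \sum_(m : 'X_{1..n.+1 < e.+1} | mdeg m == e) lam 'X_[m] *: 'X_[socle_exp - m].

Lemma le_socle m : mdeg m = e -> (m <= socle_exp)%MM.
Proof.
move=> me; apply/mnm_lepP => i; rewrite mnmE.
have : (m i <= mdeg m)%N by rewrite mdegE (bigD1 i) //= leq_addr.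
by have := s_gt i; lia.
Qed.

Lemma multiplier_homog : multiplier \is (mdeg socle_exp - e).-homog.
Proof.
apply: rpred_sum => m /eqP me; apply: rpredZ; rewrite dhomogX.
have /submK := le_socle me; move/(congr1 mdeg); rewrite mdegD me.
by move <-; rewrite addnK.
Qed.

Lemma multiplier_pairing g : g \is e.-homog ->
  (multiplier * g)@_socle_exp = lam g.
Proof.
move=> hg; rewrite [in LHS](mpolyE g) [in RHS](mpolyE g) mulr_sumr !raddf_sum
  /=.
rewrite big_seq [RHS]big_seq; apply: eq_bigr => m /(dhomog_mf hg)/= me.
rewrite -scalerAr mcoeffZ linearZ /=; congr (_ * _).
rewrite /multiplier mulr_suml raddf_sum /=.
have me' : (mdeg m < e.+1)%N by rewrite me.
rewrite (bigD1 (BMultinom me')) /= ?me // big1 => [|m' /andP[/eqP m'e mm']].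
  rewrite addr0 -scalerAl -mpolyXD submK ?le_socle // mcoeffZ mcoeffX eqxx.
  by rewrite mulr1.
rewrite -scalerAl -mpolyXD mcoeffZ mcoeffX; case: eqP => [E|]; last first.
  by rewrite mulr0.
case/eqP: mm'; apply/val_inj => /=; apply: (@addmI _ (socle_exp - m')%MM).
by rewrite E submK // le_socle.
Qed.

(** The coefficient of the product at a monomial m of the box equals the socle coefficient after
    multiplying by the complementary monomial, and that is a value of [lam] on a multiple of g. *)
Lemma multiplier_colon d g : g \is d.-homog ->
  (forall b, g * b \is e.-homog -> lam (g * b) = 0) ->
  seq_ideal power_var n.+1 (multiplier * g).
Proof.
move=> hg lamg; apply: box_free_monomial_ideal; apply/box_freeP => m hm.
have hcg := dhomogM multiplier_homog hg.
have [mE|mE] := eqVneq (mdeg m) (mdeg socle_exp - e + d)%N; last first.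
  exact: dhomog_nemf_coeff hcg mE.
rewrite -(mcoeffMX _ (socle_exp - m)%MM) submK // -mulrA.
have mS : (mdeg (socle_exp - m) + mdeg m = mdeg socle_exp)%N.
  by rewrite -mdegD submK.
have gh : g * 'X_[socle_exp - m] \is e.-homog.
  have -> : e = (d + mdeg (socle_exp - m))%N.
    have : (e <= mdeg socle_exp)%N.
      rewrite mdegE big_ord_recl mnmE /=.
      by apply: leq_trans (leq_addr _ _); have := s_gt 0%N; lia.
    by rewrite mE in mS; lia.
  by apply: dhomogM => //; rewrite dhomogX.
by rewrite multiplier_pairing // lamg.
Qed.

Lemma multiplier_nontrivial g : g \is e.-homog -> lam g != 0 ->
  ~ seq_ideal power_var n.+1 (multiplier * g).
Proof.
move=> hg /eqP lamg /monomial_ideal_subset/box_freeP/(_ _ (lepm_refl _)).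
by rewrite multiplier_pairing.
Qed.

End MonomialIdeals.

(** * Graded pieces of ideals *)

Section IdealGen.
Variable A : comNzRingType.
Implicit Types (G : set A) (a b : A).

Lemma ideal_gen_ideal G : is_ideal setT (ideal_gen G).
Proof.
split=> //.
- by exists 0, (fun=> 0), (fun=> 0); rewrite big_ord0; split=> // -[].
- move=> _ _ [m1 [c1 [g1 [_ h1 ->]]]] [m2 [c2 [g2 [_ h2 ->]]]].
  exists (m1 + m2)%N, (fun i => match split i with inl j => c1 j | inr j =>
    c2 j end),
    (fun i => match split i with inl j => g1 j | inr j => g2 j end).
  split=> // [i|]; first by case: split.
  rewrite big_split_ord /=; congr (_ + _); apply: eq_bigr => i _.
    by rewrite (unsplitK (inl i)).
  by rewrite (unsplitK (inr i)).
- move=> a _ _ [m [c [g [_ hg ->]]]]; exists m, (fun i => a * c i), g.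
  by split=> //; rewrite mulr_sumr; apply: eq_bigr => i _; rewrite mulrA.
Qed.

Lemma mem_ideal_gen G a : G a -> ideal_gen G a.
Proof.
move=> Ga; exists 1%N, (fun=> 1), (fun=> a).
by split=> //; rewrite big_ord1 mul1r.
Qed.

Lemma ideal_gen_min G J : is_ideal setT J -> G `<=` J -> ideal_gen G `<=` J.
Proof.
move=> JI GJ _ [m [c [g [_ hg ->]]]].
by apply: ideal_sum => // i _; apply: ideal_mull => //; apply: GJ.
Qed.

Lemma idealX_add G a b t : ideal_gen G a ->
  exists2 c, ideal_gen G c & (a + b) ^+ t = c + b ^+ t.
Proof.
have GI := ideal_gen_ideal G.
move=> Ga; elim: t => [|t [c Gc E]].
  by exists 0; [apply: ideal0 | rewrite add0r].
exists (a * (c + b ^+ t) + b * c).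
  by apply: (idealD GI); [exact: (ideal_mulr GI) | exact: (ideal_mull GI)].
by rewrite !exprS E; ring.
Qed.

End IdealGen.

Lemma forms_idealP (K : fieldType) (n r : nat) (f : r.-tuple {mpoly K[n]}) a :
  forms_ideal f a <-> exists b : 'I_r -> {mpoly K[n]},
    a = \sum_i b i * tnth f i.
Proof.
split=> [|[b ->]]; last first.
  by exists r, b, (tnth f); split=> // i; exists i.
apply: (@ideal_gen_min _ _ [set a | exists b : 'I_r -> {mpoly K[n]},
    a = \sum_i b i * tnth f i]).
  split=> //.
  - by exists (fun=> 0); rewrite big1 // => i _; rewrite mul0r.
  - move=> _ _ [b ->] [c ->]; exists (fun i => b i + c i).
    by rewrite -big_split /=; apply: eq_bigr => i _; rewrite mulrDl.
  - move=> c _ _ [b ->]; exists (fun i => c * b i).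
    by rewrite mulr_sumr; apply: eq_bigr => i _; rewrite mulrA.
move=> _ [i _ <-]; exists (fun j => (j == i)%:R).
rewrite (bigD1 i) //= eqxx mul1r big1 ?addr0 // => j /negPf ->.
by rewrite mul0r.
Qed.

Section Subspaces.
Variables (K : fieldType) (V : vectType K).

(** A subspace of largest dimension inside P is all of P, since a vector left out could be
    adjoined. *)
Lemma vspace_of_set (P : set V) : P 0 ->
  (forall a u v, P u -> P v -> P (a *: u + v)) ->
  exists U : {vspace V}, forall v, v \in U <-> P v.
Proof.
move=> P0 Plin.
pose Q k := `[< exists2 U : {vspace V}, (forall v, v \in U -> P v) & \dim U = k
  >].
have Q0 : exists k, Q k.
  exists 0%N; apply/asboolP; exists 0%VS; last by rewrite dimv0.
  by move=> v; rewrite memv0 => /eqP->.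
have Qle k : Q k -> (k <= \dim {:V})%N.
  by move/asboolP => [U _ <-]; apply/dimvS/subvf.
case: (ex_maxnP Q0 Qle) => k /asboolP[U UP Uk] kmax.
exists U => v; split=> [/UP//|Pv]; apply/negPn/negP => vU.
suff /kmax : Q (\dim (U + <[v]>)%VS).
  rewrite -Uk leqNgt => /negP; apply.
  rewrite ltn_neqAle dimvS ?addvSl // andbT; apply: contra vU => dE.
  have /eqP -> : (U == U + <[v]>)%VS by rewrite eqEdim addvSl (eqP dE) leqnn.
  by have := memv_add (mem0v U) (memv_line v); rewrite add0r.
apply/asboolP; exists (U + <[v]>)%VS =>
  // w /memv_addP[u uU [_ /vlineP[c ->] ->]].
by rewrite addrC; apply: Plin => //; apply: UP.
Qed.

Lemma separating_form (U : {vspace V}) (v : V) : v \notin U ->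
  exists2 phi : {linear V -> K^o}, phi v != 0 & forall u, u \in U -> phi u = 0.
Proof.
move=> vU; pose w := v - projv U v.
have w0 : w != 0.
  rewrite subr_eq0; apply: contra vU => /eqP->; exact: memv_proj.
have [i wi] : exists i, coord (vbasis {:V}) i w != 0.
  apply/existsP; apply: contraNT w0 => /existsPn wi.
  rewrite (coord_vbasis (memvf w)); apply/eqP/big1 => i _.
  by have := wi i; rewrite negbK => /eqP->; rewrite scale0r.
pose F u : K^o := coord (vbasis {:V}) i (u - projv U u).
have Flin : linear F.
  by move=> a x y; rewrite /F linearP opprD addrACA -scalerBr linearP.
pose phi : {linear V -> K^o} :=
  HB.pack F (GRing.isLinear.Build K V K^o *:%R F Flin).
exists phi => // u uU /=.
by rewrite /F projv_id // subrr linear0.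
Qed.

End Subspaces.

Section GradedPieces.
Variables (K : fieldType) (n : nat).
Local Notation R := {mpoly K[n.+1]}.
Variable J : set R.
Hypothesis JI : is_ideal setT J.

Lemma ideal_scale (c : K) (p : R) : J p -> J (c *: p).
Proof. by move=> Jp; rewrite -mul_mpolyC; apply: ideal_mull. Qed.

Lemma graded_piece_ex e :
  exists U : {vspace dhomog n.+1 K e}, forall v, v \in U <-> J (val v).
Proof.
have [||U UP] := @vspace_of_set K (dhomog n.+1 K e) [set v | J (val v)].
- exact: (ideal0 JI).
- by move=> a u v hu hv; apply: (idealD JI _ hv); apply: ideal_scale hu.
by exists U.
Qed.

(** A linear form on the degree e piece that separates x from J, extended to R through the
    projection onto degree e. *)
Lemma form_on_quotient e (x : R) : x \is e.-homog -> ~ J x ->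
  exists2 lam : {scalar R}, lam x != 0 &
    forall g, g \is e.-homog -> J g -> lam g = 0.
Proof.
move=> hx Jx; have [U UP] := graded_piece_ex e.
have [|phi phix phiU] := @separating_form _ _ U (DHomog hx).
  by apply/negP => /UP.
pose F (g : R) : K := phi (DHomog (pihomogP mdeg e g)).
have Flin : linear_for *%R F.
  move=> a u v; rewrite /F.
  have -> : DHomog (pihomogP mdeg e (a *: u + v)) =
    a *: DHomog (pihomogP mdeg e u) + DHomog (pihomogP mdeg e v).
    by apply: val_inj => /=; rewrite linearP.
  by rewrite linearP.
have FE g (hg : g \is e.-homog) : F g = phi (DHomog hg).
  by congr (phi _); apply: val_inj; rewrite /= pihomog_dE.
pose lam : {scalar R} := HB.pack F (GRing.isLinear.Build K R K *%R F Flin).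
exists lam => /=.
  by rewrite (FE _ hx).
by move=> g hg Jg; rewrite (FE _ hg) phiU //; apply/UP.
Qed.

End GradedPieces.

Section TorsionClass.
Variables (K : fieldType) (n d : nat) (f : n.+2.-tuple {mpoly K[n.+1]}).
Local Notation R := {mpoly K[n.+1]}.
Local Notation kos := (koszul K n.+1 n.+2).
Local Notation term := (@koszul_term K n.+1 n.+2).
Local Notation dd := (kdiff f).
Local Notation "a *' u" := (kscale a u) (at level 40).
Hypothesis f_homog : forall i, tnth f i \is d.-homog.

(* [x] is a class of [H^0_m(R/I)] of degree [e]; [z] is a class of
   [H^0_m(H_1)] pairing non-trivially with it under local duality. *)
Lemma dual_torsion_class (x : R) (e M : nat) :
  x \is e.-homog -> ~ forms_ideal f x -> forms_ideal f (x * 'X_ord0) ->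
  (forall i, ideal_add (forms_ideal f) 'X_ord0 ('X_i ^+ M)) ->
  (e + n.+1 <= n.+1 * d)%N ->
  exists z, [/\ term 1 z, khom (n.+1 * d - (e + n.+1)) z, dd z = 0,
    forall i, exists N, exists2 w, term 2 w & 'X_i ^+ N *' z = dd w &
    forall b, term 2 b -> z <> dd b].
Proof.
move=> hx xI xX0 XM en.
have II : is_ideal setT (forms_ideal f) by apply: ideal_gen_ideal.
have [lam lamx lamI] := form_on_quotient II hx xI.
(* By [XM], X_i^(M+1) lies in I + (X_0), so its t-th power lies in I + (X_0^t). The size of t puts
   all monomials of degree e below the socle and keeps the subtraction in [deg] from being
   truncated. Using M + 1 makes the exponents at least t even if M = 0. *)
pose t := (n.+1 + e).+1; pose s j := (if j is 0 then t else M.+1 * t)%N.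
have s_ge j : (t <= s j)%N by case: j => [|j] //=; lia.
have s_gt0 i : (0 < s i)%N by apply: leq_trans (s_ge i).
have s_gt i : (e < s i)%N by apply: leq_trans (s_ge i); lia.
have inord0 : inord 0 = ord0 :> 'I_n.+1 by apply: val_inj; rewrite /= inordK.
have power0 : power_var K n s 0 = 'X_ord0 ^+ t by rewrite /power_var inord0.
have powerX i : exists a b, [/\ forms_ideal f a,
    seq_ideal (power_var K n s) 1 b & 'X_i ^+ (M.+1 * t) = a + b].
  have [g [h [Ig E]]] := XM i.
  have Ig' : forms_ideal f ('X_i * g) by apply: ideal_mull.
  have [a Ia Ea] := idealX_add ('X_ord0 * ('X_i * h)) t Ig'.
  exists a, (('X_ord0 * ('X_i * h)) ^+ t); split=> //.
    exists 0, (('X_i * h) ^+ t); split=> //.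
    by rewrite add0r power0 exprMn.
  by rewrite -Ea exprM exprS E mulrDr mulrCA.
pose S j := (\sum_(i < j) s i)%N.
have Sge j : (0 < j)%N -> (t <= S j)%N.
  by case: j => // j _; rewrite /S big_ord_recl /= leq_addr.
(* The multiplier has degree S(n+1) - (n+1) - e, and the connecting map along y_j adds d and
   subtracts s_j. *)
pose deg j := (S j + (n.+1 - j) * d - (e + n.+1))%N.
have degS j : (j < n.+1)%N ->
    (deg j.+1 + d = s j + (S j + (n.+1 - j) * d - (e + n.+1)))%N.
  move=> jn; have E : ((n.+1 - j) * d = (n.+1 - j.+1) * d + d)%N.
    by rewrite -mulSnr; congr (_ * _)%N; lia.
  have Sr : S j.+1 = (S j + s j)%N by rewrite /S big_ord_recr.
  have le : (e + n.+1 <= S j + (n.+1 - j) * d)%N.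
    have [->|j0] := posnP j; first by rewrite subn0 (leq_trans en) // leq_addl.
    by apply: leq_trans (leq_addr _ _); apply: leq_trans (Sge j j0);
      rewrite /t; lia.
  have le' : (e + n.+1 <= S j.+1 + (n.+1 - j.+1) * d)%N.
    apply: leq_trans (leq_addr _ _); apply: leq_trans (Sge j.+1 isT).
    by rewrite /t; lia.
  move: le le'; rewrite /deg E Sr.
  by move: (S j) (s j) ((n.+1 - j.+1) * d)%N => A B C; lia.
have degE : deg n.+1 = (mdeg (socle_exp n s) - e)%N.
  have : (mdeg (socle_exp n s) + n.+1 = S n.+1)%N.
    rewrite mdegE /S -[X in (_ + X)%N]card_ord -sum1_card -big_split /=.
    by apply: eq_bigr => i _; rewrite mnmE addn1 prednK.
  by rewrite /deg subnn mul0n; lia.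
have [||||||||z [tz hz dz [w tw zw] nz]] := @torsion_class K n.+1 n.+1 d f
  (power_var K n s) s
   f_homog (power_var_homog K n s) _ _ x (multiplier s e lam) deg isT.
- by move=> j jn; apply: power_var_regular.
- by move=> [|j] // _; apply: powerX.
- by move=> j jn; rewrite degS // leq_addr.
- by move=> j jn; rewrite degS // addKn.
- rewrite power0 exprS mulrA; exact: (ideal_mulr II).
- by rewrite degE; apply: multiplier_homog.
- move=> i; apply: (multiplier_colon s_gt0 s_gt (f_homog i)) => b hb.
  apply: lamI => //; apply: (ideal_mulr II); apply: mem_ideal_gen.
  by exists i.
- exact: multiplier_nontrivial.
exists z; split=> // [|i].
  by have -> : (n.+1 * d - (e + n.+1))%N = deg 0%N;
    rewrite // /deg /S big_ord0 subn0.
(* The power is a + X_0^t c with a in I: the first summand kills z by homotopy, the second because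
   X_0^t z is the boundary of w. *)
exists (M.+1 * t)%N; have [a [b [Ia [b0 [c [b00 ->]]] ->]]] := powerX i.
have zI := @zero_ideal R.
have dz0 : kmod [set 0] (dd z) by move=> T; rewrite dz kzeroE.
have [v tv hv] := forms_kill_homology zI Ia tz dz0.
exists (v + c *' w); first by apply: ktermD => //; apply: ktermZ.
rewrite kdD kd_scale -zw kscaleA b00 add0r kscaleDl mulrC; congr (_ + _).
apply: kos_ext => T; have := hv T; rewrite kaddE koppE => /eqP.
by rewrite subr_eq0 => /eqP.
Qed.

End TorsionClass.

(** * Vanishing of H_1 and Hilbert functions *)

Section Rigidity.
Variables (K : fieldType) (n r d : nat) (f : r.-tuple {mpoly K[n]}).
Local Notation R := {mpoly K[n]}.
Local Notation kos := (koszul K n r).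
Local Notation term := (@koszul_term K n r).
Local Notation dd := (kdiff f).
Local Notation "a *' u" := (kscale a u) (at level 40).
Implicit Types (u v w z : kos) (T : {set 'I_r}).
Hypothesis f_homog : forall i, tnth f i \is d.-homog.
Hypothesis d_gt0 : (0 < d)%N.

Definition no_homology1 (e : nat) := forall a z, (a <= e)%N ->
  term 1 z -> khom a z -> dd z = 0 -> exists2 v, term 2 v & z = dd v.

(** Membership in the Koszul complex of the first [i] forms, viewed inside that of all [r]. *)
Definition ksupp (i : nat) u :=
  forall T (j : 'I_r), j \in T -> (i <= j)%N -> u T = 0.

Lemma pihomog_kd a v T : pihomog mdeg (a + d) (dd v T : R) =
  dd [ffun S => pihomog mdeg a (v S)] T.
Proof.
rewrite !kdE raddf_sum /=; apply: eq_bigr => j _.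
have h : (ksign K n T j * tnth f j : R) \is d.-homog.
  rewrite -[d]add0n; apply: dhomogM; last exact: f_homog.
  exact: ksign_homog.
by rewrite addnC (pihomogM _ _ h) ffunE.
Qed.

Lemma khom_bounding p a i z v : khom a z -> z = dd v -> term p v -> ksupp i v ->
  z = 0 \/ (d <= a)%N /\
  exists v', [/\ term p v', ksupp i v', khom (a - d) v' & z = dd v'].
Proof.
move=> hz zv tv sv; have [da|ad] := leqP d a; last first.
  left; apply: kos_ext => T; rewrite kzeroE -[LHS](pihomog_dE (hz T)) zv kdE.
  rewrite raddf_sum big1 //= => j _.
  have h : (ksign K n T j * tnth f j : R) \is d.-homog.
    rewrite -[d]add0n; apply: dhomogM; last exact: f_homog.
    exact: ksign_homog.
  exact: (pihomogM_lt _ h ad).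
right; split=> //; exists [ffun S => pihomog mdeg (a - d) (v S)]; split.
- by move=> T hT; rewrite ffunE tv // raddf0.
- by move=> T j jT ij; rewrite ffunE (sv T j) // raddf0.
- by move=> T; rewrite ffunE; apply: pihomogP.
- apply: kos_ext => T; rewrite -pihomog_kd subnK // -zv.
  by rewrite pihomog_dE.
Qed.

(** Graded rigidity. Modulo boundaries, a 1-cycle on the first i forms that bounds on i + 1 forms is
    f_o times a 1-cycle of degree lower by d. Induction on the degree plays the part of Nakayama's
    lemma. *)
Lemma no_homology1_sub e i : no_homology1 e -> (i <= r)%N ->
  forall a z, (a <= e)%N -> term 1 z -> khom a z -> ksupp i z -> dd z = 0 ->
  exists v, [/\ term 2 v, ksupp i v & z = dd v].
Proof.
move=> H; move Ek: (r - i)%N => k; elim: k i Ek => [|k IH] i Ek ir.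
  move=> a z ae tz hz _ dz; have [v tv zv] := H a z ae tz hz dz.
  by exists v; split=> // T j _; have := ltn_ord j; lia.
have ilt : (i < r)%N by lia.
have IHi := IH i.+1 ltac:(lia) ilt; pose o := Ordinal ilt.
elim/ltn_ind => a IHa z ae tz hz sz dz.
have [|v0 [tv0 sv0 zv0]] := IHi a z ae tz hz _ dz.
  by move=> T j jT ij; apply: (sz T j) => //; apply: ltnW.
have [z0|[da [v [tv sv hv zv]]]] := khom_bounding hz zv0 tv0 sv0.
  exists 0; split; [exact: kterm0 | by move=> T j _ _; rewrite kzeroE |].
  by rewrite kd0.
(* Write v as v' + e_o wedge w with e_o absent from v' and w. Since z does not involve e_o,
   comparing the components that do gives dw = 0. *)
pose w : kos := [ffun T : {set 'I_r} =>
  if o \in T then 0 else ksign K n T o * v (o |: T)%SET].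
have wE T : w T = (if o \in T then 0 else ksign K n T o * v (o |: T)%SET) :> R.
  by rewrite ffunE.
pose v' : kos := [ffun T : {set 'I_r} => if o \in T then 0 else v T].
have v'E T : v' T = (if o \in T then 0 else v T) :> R by rewrite ffunE.
have vE : v = v' + wedge o w.
  apply: kos_ext => T; rewrite kaddE v'E wedgeE wE.
  case: ifP => oT; last by rewrite addr0.
  rewrite in_setD1 eqxx /= finset.setD1K // mulrA add0r.
  have -> : ksign K n (T :\ o) o = ksign K n T o.
    by rewrite -[in RHS](finset.setD1K oT) ksignU ?inE ?eqxx // ltnn mulr1.
  by rewrite ksign_sqr mul1r.
have tw : term 1 w.
  move=> T hT; rewrite wE; case: ifPn => // oT; rewrite tv ?mulr0 //.
  by rewrite cardsU1 oT.
have hw : khom (a - d) w.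
  move=> T; rewrite wE; case: ifP => _; first exact: dhomog0.
  rewrite -[(a - d)%N]add0n; apply: dhomogM; last exact: hv.
  exact: ksign_homog.
have sw : ksupp i w.
  move=> T j jT ij; rewrite wE; case: ifPn => // oT.
  rewrite (sv _ j) ?mulr0 ?inE ?jT ?orbT //.
  rewrite ltn_neqAle ij andbT; apply: contraNneq oT => ij'.
  by rewrite (_ : o = j) //; apply: val_inj.
have sv' : ksupp i v'.
  move=> T j jT ij; rewrite v'E; case: ifPn => // oT.
  rewrite (sv _ j) //.
  rewrite ltn_neqAle ij andbT; apply: contraNneq oT => ij'.
  by rewrite (_ : o = j) //; apply: val_inj.
have zE : z = dd v' + (tnth f o *' w - wedge o (dd w)).
  by rewrite zv vE kdD kd_wedge.
have dw : dd w = 0.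
  apply: kos_ext => S; rewrite kzeroE.
  have [oS|oS] := boolP (o \in S).
    by rewrite kdE big1 // => j _; rewrite wE inE oS orbT mulr0.
  have := congr1 (fun u : kos => u (o |: S)%SET : R) zE.
  rewrite (sz _ o) ?setU11 ?inE ?eqxx //= !kaddE koppE kscaleE wE wedgeE.
  rewrite kdE big1 => [|j _]; last by rewrite v'E !inE eqxx !orbT mulr0.
  rewrite !inE eqxx /= mulr0 !add0r finset.setU1K // => /esym/eqP.
  rewrite oppr_eq0 => /eqP E.
  have := congr1 (fun q => ksign K n (o |: S) o * q) E.
  by rewrite /= mulrA ksign_sqr mul1r mulr0.
have [||w' [tw' sw' ww']] := IHa (a - d)%N _ w _ tw hw sw dw.
- by lia.
- by lia.
exists (v' + tnth f o *' w'); split.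
- apply: ktermD; last exact: ktermZ.
  by move=> T hT; rewrite v'E tv // if_same.
- by move=> T j jT ij; rewrite kaddE kscaleE (sv' T j) // (sw' T j) // mulr0
  addr0.
- rewrite kdD kd_scale -ww' zE dw.
  congr (_ + _); apply: kos_ext => T; rewrite kaddE koppE wedgeE kzeroE.
  by rewrite mulr0 if_same subr0.
Qed.

Definition partial_ideal (i : nat) : set R :=
  [set p | exists b : 'I_r -> R, p = \sum_(j < r | (j < i)%N) b j * tnth f j].

Lemma partial_ideal_ideal i : is_ideal setT (partial_ideal i).
Proof.
split=> //.
- by exists (fun=> 0); rewrite big1 // => j _; rewrite mul0r.
- move=> _ _ [b ->] [c ->]; exists (fun j => b j + c j).
  by rewrite -big_split /=; apply: eq_bigr => j _; rewrite mulrDl.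
- move=> c _ _ [b ->]; exists (fun j => c * b j).
  by rewrite mulr_sumr; apply: eq_bigr => j _; rewrite mulrA.
Qed.

Lemma partial_ideal_full : partial_ideal r = forms_ideal f.
Proof.
apply/seteqP; split=> p; [move=> [b ->];
  apply/forms_idealP|move/forms_idealP => [b ->]];
  by exists b; apply: eq_bigl => j; rewrite ltn_ord.
Qed.

Lemma partial_ideal_homog i a p : p \is (a + d).-homog -> partial_ideal i p ->
  exists2 b : 'I_r -> R, forall j, b j \is (a).-homog &
    p = \sum_(j < r | (j < i)%N) b j * tnth f j.
Proof.
move=> hp [b E]; exists (fun j => pihomog mdeg a (b j)).
  by move=> j; apply: pihomogP.
rewrite -[LHS](pihomog_dE hp) E raddf_sum; apply: eq_bigr => j _ /=.
by rewrite mulrC addnC (pihomogM _ _ (f_homog j)) mulrC.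
Qed.

(** A relation expressing f_o p through the earlier forms is a 1-cycle on the first i + 1 forms with
    coefficient p at e_o. It is a boundary on these forms, and the e_o coefficient of such a
    boundary lies in the ideal of the first i. *)
Lemma partial_ideal_colon e (i : nat) (o : 'I_r) a p : no_homology1 e -> (a <=
  e)%N ->
  i = o :> nat -> p \is (a).-homog -> partial_ideal i (tnth f o * p) ->
  partial_ideal i p.
Proof.
move=> H ae io hp Ip.
have [b hb E] : exists2 b : 'I_r -> R, forall j, b j \is (a).-homog &
    tnth f o * p = \sum_(j < r | (j < i)%N) b j * tnth f j.
  by apply: partial_ideal_homog => //; rewrite addnC; apply: dhomogM.
pose c (j : 'I_r) : R := if j == o then p else if (j < i)%N then - b j else 0.
pose u : kos := [ffun T : {set 'I_r} =>
  if #|T| == 1%N then \sum_(j in T) c j else 0].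
have uE T : u T = (if #|T| == 1%N then \sum_(j in T) c j else 0) :> R
  by rewrite ffunE.
have u1 j : u [set j]%SET = c j :> R by rewrite uE cards1 eqxx big_set1.
have tu : term 1 u by move=> T /negPf hT; rewrite uE hT.
have hu : khom a u.
  move=> T; rewrite uE; case: ifP => _; last exact: dhomog0.
  apply: rpred_sum => j _; rewrite /c; case: ifP => // _.
  by case: ifP => _; [rewrite rpredN; exact: hb | exact: dhomog0].
have su : ksupp i.+1 u.
  move=> T j jT ij; rewrite uE; case: ifP => // /cards1P[l Tl].
  rewrite Tl inE in jT; rewrite Tl big_set1 /c -(eqP jT).
  rewrite -(inj_eq val_inj) /= -io; case: eqP => [|_]; first by lia.
  by rewrite ltnNge ltnW.
have du : dd u = 0.
  apply: kos_ext => T; rewrite kzeroE kdE.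
  have [->|T0] := eqVneq T finset.set0; last first.
    apply: big1 => j jT; rewrite uE cardsU1 jT /= add1n eqSS.
    by rewrite cards_eq0 (negPf T0) mulr0.
  rewrite (bigD1 o) ?inE //= finset.setU0 u1 {1}/c eqxx /ksign.
  have s0 (j : 'I_r) : [set x in (finset.set0 : {set 'I_r}) | (x < j)%N]%SET =
    finset.set0.
    by apply/setP => x; rewrite !inE.
  rewrite s0 cards0 expr0 mul1r E.
  rewrite [X in _ + X](bigID (fun j : 'I_r =>
    (j < i)%N)) /= [X in _ + (_ + X)]big1 ?addr0.
    rewrite [X in _ + X](eq_bigl (fun j : 'I_r => (j < i)%N)); last first.
      move=> j; rewrite inE /= -(inj_eq val_inj) /= -io.
      by case: ltngtP.
    rewrite -big_split /=; apply: big1 => j ji; rewrite s0 cards0 expr0 mul1r.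
    rewrite finset.setU0 u1 /c ji -(inj_eq val_inj) /= -io.
    by move: ji; case: ltngtP => // _ _; rewrite mulrN mulrC subrr.
  move=> j /andP[/andP[_ jo] ji]; rewrite finset.setU0 u1 /c (negPf jo) (negPf
    ji).
  by rewrite mulr0.
have ir : (i.+1 <= r)%N by rewrite io.
have [v [tv sv uv]] := no_homology1_sub H ir ae tu hu su du.
have := u1 o; rewrite /c eqxx uv kdE => <-.
exists (fun j => ksign K n [set o]%SET j * v (j |: [set o])%SET).
rewrite (bigID (fun j : 'I_r => (j < i)%N)) /= [X in _ + X]big1 ?addr0.
  apply: eq_big => [j|j _]; last by rewrite mulrAC.
  rewrite inE -(inj_eq val_inj) /= -io.
  by case: ltngtP.
move=> j /andP[jo ji]; rewrite (sv _ j) ?mulr0 ?inE ?eqxx //.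
move: jo ji; rewrite inE -(inj_eq val_inj) /= -io; lia.
Qed.

End Rigidity.

(** * Hilbert functions of graded quotients *)

Section HilbertFunction.
Variables (K : fieldType) (n : nat).
Local Notation R := {mpoly K[n.+1]}.
Implicit Types (J : set R) (p g : R).

Definition graded_piece J (JI : is_ideal setT J) e : {vspace dhomog n.+1 K e} :=
  sval (cid (graded_piece_ex JI e)).

Lemma graded_pieceP J (JI : is_ideal setT J) e v :
  v \in graded_piece JI e <-> J (val v).
Proof. exact: (svalP (cid (graded_piece_ex JI e))). Qed.

(** The dimension of (R/J)_e, valued in [int] so that differences are honest. *)
Definition hilb J (JI : is_ideal setT J) e : int :=
  'C(e + n, e)%:Z - (\dim (graded_piece JI e))%:Z.

Lemma dim_dhomog e : \dim {:dhomog n.+1 K e} = 'C(e + n, e).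
Proof. exact: dimvf. Qed.

Lemma hilb0 (JI : is_ideal setT ([set 0] : set R)) e :
  hilb JI e = 'C(e + n, e)%:Z.
Proof.
rewrite /hilb (_ : graded_piece JI e = 0%VS) ?dimv0 ?subr0 //.
apply/eqP; rewrite -subv0; apply/subvP => v /graded_pieceP /= v0.
by rewrite memv0; apply/eqP/val_inj.
Qed.

Section Multiplication.
Variables (s e : nat) (g : R).
Hypotheses (g_homog : g \is s.-homog) (g_neq0 : g != 0).

Definition mulg_fun (p : dhomog n.+1 K e) : dhomog n.+1 K (s + e) :=
  DHomog (dhomogM g_homog (dhomog_is_dhomog p)).

Lemma mulg_linear : linear mulg_fun.
Proof.
move=> c p q; apply: val_inj => /=.
by rewrite mulrDr scalerAr.
Qed.

HB.instance Definition _ := GRing.isLinear.Build K _ _ *:%R mulg_fun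
  mulg_linear.

Definition mulg_hom : 'Hom(dhomog n.+1 K e, dhomog n.+1 K (s + e)) :=
  linfun mulg_fun.

Lemma mulg_homE (p : dhomog n.+1 K e) : val (mulg_hom p) = g * val p.
Proof. by rewrite lfunE. Qed.

Lemma lker_mulg : lker mulg_hom == 0%VS.
Proof.
apply/lker0P => p q /(congr1 val); rewrite !mulg_homE => /(mulfI g_neq0).
exact: val_inj.
Qed.

Lemma dim_add_mulg J (JI : is_ideal setT J) :
  (forall p, p \is e.-homog -> J (g * p) -> J p) ->
  (\dim (graded_piece JI (s + e) + limg mulg_hom) + \dim (graded_piece JI e) =
   \dim (graded_piece JI (s + e)) + 'C(e + n, e))%N.
Proof.
move=> inj.
have cap : (graded_piece JI (s + e) :&: limg mulg_hom =
            mulg_hom @: graded_piece JI e)%VS.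
  apply/eqP; rewrite eqEsubv; apply/andP; split; apply/subvP => v.
    case/memv_capP => /graded_pieceP + /memv_imgP[p _ vp].
    rewrite vp mulg_homE => /(inj _ (dhomog_is_dhomog p)) Jp.
    by apply/memv_imgP; exists p => //; apply/graded_pieceP.
  case/memv_imgP => p /graded_pieceP Jp ->; apply/memv_capP; split.
    by apply/graded_pieceP; rewrite mulg_homE; apply: ideal_mull.
  by apply/memv_imgP; exists p; rewrite ?memvf.
have inj_dim (U : {vspace dhomog n.+1 K e}) : \dim (mulg_hom @: U) = \dim U.
  by apply: limg_dim_eq; rewrite (eqP lker_mulg) capv0.
by rewrite -(inj_dim (graded_piece JI e)) -cap dimv_sum_cap inj_dim dim_dhomog.
Qed.

Lemma hilb_mono J (JI : is_ideal setT J) :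
  (forall p, p \is e.-homog -> J (g * p) -> J p) ->
  hilb JI e <= hilb JI (s + e).
Proof.
move=> /dim_add_mulg - /(_ JI) E; rewrite /hilb.
have : (\dim (graded_piece JI (s + e) + limg mulg_hom)%VS <= 'C(s + e + n, s +
  e))%N.
  by rewrite -dim_dhomog; apply/dimvS/subvf.
lia.
Qed.

(** Additivity along (R/J)_e -> (R/J)_(s+e) -> (R/J')_(s+e), where J' is J + (g) in degree s + e and
    multiplication by g is injective on degree e. *)
Lemma hilb_add J J' (JI : is_ideal setT J) (JI' : is_ideal setT J') :
  (forall p, p \is e.-homog -> J (g * p) -> J p) ->
  (forall p, p \is (s + e).-homog ->
     J' p <-> exists2 q, q \is e.-homog & J (p - g * q)) ->
  hilb JI' (s + e) = hilb JI (s + e) - hilb JI e.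
Proof.
move=> /dim_add_mulg - /(_ JI) E JJ'; rewrite /hilb.
have -> : graded_piece JI' (s + e) = (graded_piece JI (s + e) + limg
  mulg_hom)%VS.
  apply/vspaceP => v; apply/idP/idP.
    move/graded_pieceP/(JJ' _ (dhomog_is_dhomog v)) => [q hq Jq].
    apply/memv_addP; exists (v - mulg_hom (DHomog hq)).
      apply/graded_pieceP.
      have -> : val (v - mulg_hom (DHomog hq)) = val v - val (mulg_hom (DHomog
        hq)) by [].
      by rewrite mulg_homE.
    by exists (mulg_hom (DHomog hq)); [apply: memv_img;
      apply: memvf | rewrite subrK].
  case/memv_addP => u /graded_pieceP Ju [_ /memv_imgP[q _ ->] ->].
  apply/graded_pieceP/(JJ' _ (dhomog_is_dhomog _)); exists (val q).
    exact: dhomog_is_dhomog.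
  have -> : val (u + mulg_hom q) = val u + val (mulg_hom q) by [].
  by rewrite mulg_homE addrK.
lia.
Qed.

Lemma hilb_lt J J' (JI : is_ideal setT J) (JI' : is_ideal setT J') a :
  (forall p, p \is (a).-homog -> J' p <-> J p) -> hilb JI' a = hilb JI a.
Proof.
move=> JJ'; rewrite /hilb; congr (_ - (\dim _)%:Z); apply/vspaceP => v.
by apply/idP/idP => /graded_pieceP /(JJ' _ (dhomog_is_dhomog v))/graded_pieceP.
Qed.

End Multiplication.

End HilbertFunction.

(** * Coefficients of powers of 1 + t + ... + t^(d-1) *)

Section BoxCoefficients.
Variable d : nat.
Hypothesis d_gt0 : (0 < d)%N.
Implicit Types (g : int -> int) (a b z : int).

(** On generating series, [dif s] is multiplication by 1 - t^s and [win] by 1 + t + ... + t^(d-1).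
    Arguments in [int] avoid truncation at degree 0. *)
Definition dif (s : nat) g z : int := g z - g (z - s%:Z).
Definition win g z : int := \sum_(i < d) g (z - i%:Z).

Lemma difC s t g : dif s (dif t g) = dif t (dif s g).
Proof.
apply/funext => z; rewrite /dif (_ : z - s%:Z - t%:Z = z - t%:Z - s%:Z); lia.
Qed.

Lemma dif_winC s g : dif s (win g) = win (dif s g).
Proof.
apply/funext => z; rewrite /dif /win sumrB; congr (_ - _).
by apply: eq_bigr => i _; congr g; lia.
Qed.

Lemma dif1_win g : dif 1 (win g) = dif d g.
Proof.
apply/funext => z; rewrite /dif /win.
case: (d) d_gt0 => // d' _; rewrite big_ord_recl big_ord_recr /=.
rewrite (eq_bigr (fun i : 'I_d' => g (z - 1 - i%:Z))) => [|i _]; last first.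
  by rewrite /bump /=; congr g; lia.
rewrite subr0 (_ : z - 1 - d'%:Z = z - d'.+1%:Z); last by lia.
by rewrite opprD addrA addrK.
Qed.

Lemma iter_commute (T : Type) (h1 h2 : T -> T) k (x : T) :
  (forall y, h1 (h2 y) = h2 (h1 y)) -> h1 (iter k h2 x) = iter k h2 (h1 x).
Proof. by move=> hC; elim: k => //= k IH; rewrite hC IH. Qed.

Definition delta0 z : int := (z == 0)%:Z.
(** The coefficients of 1/(1 - t)^(n+1). *)
Definition bin_fun (n : nat) z : int :=
  if z is Posz m then 'C(m + n, m)%:Z else 0.

Lemma int_pred_pos m : m.+1%:Z - 1%:Z = m%:Z. Proof. lia. Qed.
Lemma int_pred_neg m : Negz m - 1%:Z = Negz m.+1. Proof. lia. Qed.

Lemma dif1_bin0 : dif 1 (bin_fun 0) = delta0.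
Proof.
apply/funext => -[[|m]|m]; rewrite /dif ?int_pred_pos ?int_pred_neg //=.
by rewrite !addn0 !binn subrr.
Qed.

Lemma dif1_bin n : dif 1 (bin_fun n.+1) = bin_fun n.
Proof.
apply/funext => -[[|m]|m]; rewrite /dif ?int_pred_pos ?int_pred_neg //=.
  by rewrite !bin0 subr0.
by rewrite addSn binS !addSnnS; lia.
Qed.

(* Coefficients of [(1 + t + ... + t^(d-1))^m]. *)
Definition box (m : nat) : int -> int := iter m win delta0.
Arguments box : simpl never.

Lemma dif_bin n : iter n (dif d) (bin_fun n) = iter n win (bin_fun 0).
Proof.
elim: n => // n IH; rewrite iterSr -dif1_win dif_winC dif1_bin.
rewrite -(iter_commute (h1 := win)) ?IH // => g; exact/esym/dif_winC.
Qed.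

(** In series: (1 - t)(1 - t^d)^(n+2)/(1 - t)^(n+1) = (1 - t^d)^2 ((1 - t^d)/(1 - t))^n. *)
Lemma dif1_dif_bin n : dif 1 (iter n.+2 (dif d) (bin_fun n)) =
  dif d (dif d (box n)).
Proof.
rewrite !iterS dif_bin 2!(difC 1) (iter_commute (h1 := dif 1)) ?dif1_bin0 //.
exact: dif_winC.
Qed.

Lemma box_neg m z : z < 0 -> box m z = 0.
Proof.
elim: m z => [|m IH] z z0; first by rewrite /box /= /delta0; case: eqP => //;
  lia.
by rewrite /box iterS /win big1 // => i _; apply: IH; lia.
Qed.

Lemma box0 m : box m 0 = 1.
Proof.
elim: m => // m IH; rewrite /box iterS /win.
rewrite (bigD1 (Ordinal d_gt0)) //= big1 => [|i i0]; last first.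
  apply: box_neg; have : (i != 0 :> nat)%N by apply: contra i0 => /eqP i0;
    apply/eqP/val_inj.
  lia.
by rewrite subr0 addr0; exact: IH.
Qed.

Lemma box_sym m z : box m z = box m ((m * d.-1)%N%:Z - z).
Proof.
elim: m z => [|m IH] z; first by rewrite /box /= /delta0 mul0n;
  congr (_%:Z : int); lia.
rewrite /box !iterS /win (reindex_inj rev_ord_inj) /=.
apply: eq_bigr => i _; rewrite -!/(box m _) IH; congr box.
have := ltn_ord i; rewrite mulSn; lia.
Qed.

(** The second hypothesis says that b is no farther from the centre than a, on either side. The
    induction needs this generality: a step of size 1 for m + 1 is a comparison for m of two points
    d apart, which may straddle the centre. *)
Lemma box_unimodal m a b :
  a <= b -> a + b <= (m * d.-1)%N%:Z -> box m a <= box m b.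
Proof.
elim: m a b => [|m IH] a b ab abm.
  by rewrite /box /= /delta0; case: eqP => [a0|_] //; case: eqP => //; lia.
have step z : z + z + 1 <= (m.+1 * d.-1)%N%:Z -> box m.+1 z <= box m.+1 (z + 1).
  move=> hz; have := congr1 (@^~ (z + 1)) (dif1_win (box m)).
  rewrite /dif -![win _]/(box m.+1) (_ : z + 1 - 1 = z); last by lia.
  have : box m (z + 1 - d%:Z) <= box m (z + 1).
    by apply: IH; [lia | rewrite mulSn in hz; lia].
  lia.
have mono c : a <= c -> c + c <= (m.+1 * d.-1)%N%:Z -> box m.+1 a <= box m.+1 c.
  move=> ac; have [k ->] : exists k : nat, c = a + k%:Z.
    by exists `|c - a|%N; lia.
  elim: k {ac c} => [|k IHk] hk; first by rewrite addr0.
  apply: le_trans (IHk _) _; first by lia.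
  rewrite (_ : a + k.+1%:Z = a + k%:Z + 1); last by lia.
  by apply: step; lia.
have [bm|bm] := leP (b + b) (m.+1 * d.-1)%N%:Z; first exact: mono.
by rewrite [X in _ <= X]box_sym; apply: mono; lia.
Qed.

Lemma box_incr m b : 0 <= b -> b + b <= (m.+1 * d.-1)%N%:Z ->
  box m.+1 (b - d%:Z) < box m.+1 b.
Proof.
elim: m b => [|m IH] b b0 bm.
  rewrite box_neg; last by rewrite mul1n in bm; lia.
  apply: lt_le_trans (box_unimodal b0 _); first by rewrite box0.
  by rewrite add0r; lia.
rewrite /box [in X in X < _]iterS [in X in _ < X]iterS.
rewrite -![iter _ win _]/(box m.+1) /win -subr_gt0 -sumrB.
have ge0 (i : 'I_d) : 0 <= box m.+1 (b - i%:Z) - box m.+1 (b - d%:Z - i%:Z).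
  rewrite subr_ge0; apply: box_unimodal; first by lia.
  by rewrite mulSn in bm; have := ltn_ord i; lia.
(* One term of the window is strict: the last one, by induction, if b >= d - 1; otherwise the one at
   i = b, which compares the constant coefficient 1 with a coefficient in negative degree. *)
have [i gt0] : exists i : 'I_d,
    0 < box m.+1 (b - i%:Z) - box m.+1 (b - d%:Z - i%:Z).
  have [bd|bd] := leP d.-1%:Z b.
    have dd : (d.-1 < d)%N by lia.
    exists (Ordinal dd) => /=; rewrite subr_gt0.
    rewrite (_ : b - d%:Z - d.-1%:Z = b - d.-1%:Z - d%:Z); last by lia.
    by apply: IH; rewrite mulSn in bm; lia.
  have bd' : (`|b| < d)%N by lia.
  exists (Ordinal bd') => /=; rewrite (_ : b - `|b|%N%:Z = 0); last by lia.
  by rewrite box0 box_neg //; lia.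
rewrite (bigD1 i) //=; apply: ltr_pwDl => //.
by apply: sumr_ge0 => j _.
Qed.

(** Even after rounding down, 2e + d >= (m+1)(d-1), so e + d is no closer to the centre than e;
    strictness comes from e - d. *)
Lemma second_difference_lt0 m e : e = (m * d.-1)./2 ->
  dif d (dif d (box m.+1)) (e + d)%N%:Z < 0.
Proof.
move=> ee; rewrite /dif !PoszD.
rewrite (_ : e%:Z + d%:Z - d%:Z = e%:Z); last by lia.
have h1 : box m.+1 (e%:Z - d%:Z) < box m.+1 e%:Z.
  by apply: box_incr => //; rewrite mulSn; lia.
have h2 : box m.+1 (e%:Z + d%:Z) <= box m.+1 e%:Z.
  rewrite box_sym; apply: box_unimodal; rewrite mulSn; lia.
lia.
Qed.

End BoxCoefficients.

Section HilbertDrop.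
Variables (K : fieldType) (m d : nat).
Local Notation n := m.+1.
Variable f : n.+2.-tuple {mpoly K[n.+1]}.
Local Notation R := {mpoly K[n.+1]}.
Hypothesis f_homog : forall i, tnth f i \is d.-homog.
Hypothesis d_gt0 : (0 < d)%N.
Hypothesis f_neq0 : forall i, tnth f i != 0.

Definition hilb_partial i (z : int) : int :=
  if z is Posz a then hilb (partial_ideal_ideal f i) a else 0.

Lemma hilb_partial0 : hilb_partial 0 = bin_fun n.
Proof.
apply/funext => -[a|//] /=; rewrite -(hilb0 (@zero_ideal R)).
apply: hilb_lt => p _; split=> [[b ->]|->]; first by rewrite big1.
by exists (fun=> 0); rewrite big1.
Qed.

Lemma partial_ideal_low i a p : (a < d)%N -> p \is (a).-homog ->
  partial_ideal f i p -> p = 0.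
Proof.
move=> ad hp [b pE]; rewrite -(pihomog_dE hp) pE raddf_sum big1 //= => j _.
by rewrite mulrC (pihomogM_lt _ (f_homog j)).
Qed.

Lemma partial_idealS (i : nat) (o : 'I_n.+2) a p : i = o :> nat -> p \is (d +
  a).-homog ->
  partial_ideal f i.+1 p <->
  exists2 q, q \is (a).-homog & partial_ideal f i (p - tnth f o * q).
Proof.
move=> io hp.
have sumS (b : 'I_n.+2 -> R) : \sum_(j < n.+2 | (j < i.+1)%N) b j * tnth f j =
    b o * tnth f o + \sum_(j < n.+2 | (j < i)%N) b j * tnth f j.
  rewrite (bigD1 o) /= ?io //; congr (_ + _); apply: eq_bigl => j.
  by rewrite -(inj_eq val_inj) /= ltnS andbC ltn_neqAle.
split=> [Ip|[q hq [b pE]]].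
  rewrite addnC in hp; have [b hb pE] := partial_ideal_homog f_homog hp Ip.
  exists (b o) => //; exists b.
  by rewrite pE sumS [b o * _]mulrC addrC addKr.
exists (fun j => if j == o then q else b j).
rewrite sumS eqxx -[LHS](subrK (tnth f o * q)) pE addrC mulrC; congr (_ + _).
apply: eq_bigr => j; rewrite -(inj_eq val_inj) /= -io.
by case: ltngtP.
Qed.

(** The next form is injective modulo the previous ones in degree z - d <= e, which is where the
    range up to e + d comes from. *)
Lemma hilb_partialS e i (z : int) : no_homology1 f e -> (i < n.+2)%N ->
  z <= (e + d)%N%:Z -> hilb_partial i.+1 z = dif d (hilb_partial i) z.
Proof.
move=> H ir; case: z => [a|a] ze; last first.
  by rewrite /dif (_ : Negz a - d%:Z = Negz (a + d)) ?subr0 //; lia.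
have [ad|da] := ltnP a d.
  rewrite /dif (_ : a%:Z - d%:Z = Negz (d - a.+1)) ?subr0 /=; last by lia.
  apply: hilb_lt => p hp; split=> /(partial_ideal_low ad hp)->;
    exact: (ideal0 (partial_ideal_ideal f _)).
have [c aE] : exists c, a = (d + c)%N by exists (a - d)%N; lia.
rewrite /dif aE (_ : (d + c)%N%:Z - d%:Z = c%:Z); last by lia.
pose o := Ordinal ir.
apply: (hilb_add (f_homog o) (f_neq0 o)) => p hp.
  have ce : (c <= e)%N by rewrite lez_nat in ze; lia.
  by move=> Ip; have := partial_ideal_colon f_homog d_gt0 H ce (erefl : i = o)
    hp Ip.
exact: partial_idealS.
Qed.

Lemma hilb_partialE e i (z : int) : no_homology1 f e -> (i <= n.+2)%N ->
  z <= (e + d)%N%:Z -> hilb_partial i z = iter i (dif d) (bin_fun n) z.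
Proof.
move=> H; elim: i z => [|i IH] z ir ze; first by rewrite hilb_partial0.
by rewrite (hilb_partialS H) // iterS /dif !IH //; lia.
Qed.

Lemma annihilated_by_linear_form (l : R) (e := (m * d.-1)./2) :
  no_homology1 f e -> l \is 1.-homog -> l != 0 ->
  exists x, [/\ x \is (e + d.-1).-homog, ~ forms_ideal f x &
                forms_ideal f (l * x)].
Proof.
move=> H hl l0; apply: contrapT => noX.
have inj p : p \is (e + d.-1).-homog -> partial_ideal f n.+2 (l * p) ->
    partial_ideal f n.+2 p.
  rewrite partial_ideal_full => hp lp; apply: contrapT => np.
  by apply: noX; exists p.
have := hilb_mono hl l0 (partial_ideal_ideal f n.+2) inj.
have := second_difference_lt0 d_gt0 (erefl e).
rewrite -dif1_dif_bin // /dif -!(hilb_partialE H) //; last by lia.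
rewrite (_ : (e + d)%N%:Z - 1%:Z = (e + d.-1)%N%:Z); last by lia.
by rewrite (_ : (e + d = 1 + (e + d.-1))%N) /=; lia.
Qed.

End HilbertDrop.

(** * Ideals of dimension at most one *)

Lemma int_max (B : set int) (a u : int) : B a -> (forall x, B x -> x <= u) ->
  exists2 b, B b & forall x, B x -> x <= b.
Proof.
move=> Ba Bu; pose Q (k : nat) := `[< B (u - k%:Z) >].
have Q0 : exists k, Q k.
  exists `|u - a|%N; apply/asboolP; have := Bu a Ba => au.
  by rewrite (_ : u - `|u - a|%N%:Z = a) //; lia.
case: (ex_minnP Q0) => k /asboolP Bk kmin; exists (u - k%:Z) => // x Bx.
have xu := Bu x Bx; have /kmin : Q `|u - x|%N.
  by apply/asboolP; rewrite (_ : u - `|u - x|%N%:Z = x) //; lia.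
lia.
Qed.

(** [supremum] is informative only once some least upper bound is exhibited: a maximum if B is
    bounded above, and +oo otherwise. *)
Lemma le_zsup (B : set int) (a : int) : B a -> (a%:E <= zsup B)%E.
Proof.
move=> Ba; apply: ge_supremum_Nmem; last by exists a.
have [[u Bu]|noub] := pselect (exists u, forall x, B x -> x <= u).
  have [b Bb bmax] := int_max Ba Bu; exists b%:E; split.
    by move=> _ [x Bx <-]; rewrite lee_fin; apply: bmax.
  by move=> y; apply; exists b.
exists +oo%E; split=> [y _|[u| |] uB]; rewrite ?leey //.
  case: noub; exists u => x Bx; rewrite -lee_fin.
  by apply: uB; exists x.
by have := uB _ (ex_intro2 _ _ a Ba erefl); rewrite leeNy_eq.
Qed.

Lemma zinf_le (B : set int) (a : int) : B a -> (zinf B <= a%:E)%E.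
Proof.
move=> Ba; apply: le_infimum_Nmem; last by exists a.
have [[l Bl]|nolb] := pselect (exists l, forall x, B x -> l <= x).
  have BNa : [set x | B (- x)] (- a) by rewrite /= opprK.
  have [|b Bb bmax] := @int_max [set x | B (- x)] (- a) (- l) BNa.
    by move=> x /= /Bl; lia.
  exists (- b)%:E; split.
    move=> _ [x Bx <-]; rewrite lee_fin; have := bmax (- x).
    by rewrite /= opprK => /(_ Bx); lia.
  by move=> y; apply; exists (- b).
exists -oo%E; split=> [y _|[l| |] lB]; rewrite ?leNye //.
  case: nolb; exists l => x Bx; rewrite -lee_fin.
  by apply: lB; exists x.
by have := lB _ (ex_intro2 _ _ a Ba erefl); rewrite leye_eq.
Qed.

Section PrimeAvoidance.
Variable A : comNzRingType.
Implicit Types (J S P : set A) (a b c u : A).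

Lemma prime_disjoint J S : is_ideal setT J -> S 1 ->
  (forall a b, S a -> S b -> S (a * b)) -> (forall a, J a -> ~ S a) ->
  exists P, [/\ is_prime setT P, J `<=` P & forall a, P a -> ~ S a].
Proof.
move=> JI S1 SM JS.
(* Zorn's lemma is applied to the ideals united with [J], so that the union of
   the empty chain is covered. *)
pose good P := is_ideal setT (P `|` J) /\ forall a, (P `|` J) a -> ~ S a.
have [F Fgood Ftot|P [[PI PS] Pmax]] := @Zorn_bigcup A good.
  have mem2 a b : (\bigcup_(X in F) X `|` J) a -> (\bigcup_(X in F) X `|` J) b
    ->
      exists2 X, (X = set0 \/ F X) & (X `|` J) a /\ (X `|` J) b.
    move=> [[X FX Xa]|Ja] [[Y FY Yb]|Jb].
    - have [XY|YX] := Ftot X Y FX FY.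
        by exists Y; [right | split; left => //; apply: XY].
      by exists X; [right | split; left => //; apply: YX].
    - by exists X; [right | split; [left | right]].
    - by exists Y; [right | split; [right | left]].
    - by exists set0; [left | split; right].
  have sub X : X = set0 \/ F X -> X `|` J `<=` \bigcup_(X in F) X `|` J.
    move=> [->|FX] a [Xa|Ja]; [by [] | by right | by left; exists X | by right].
  have XI X : X = set0 \/ F X -> is_ideal setT (X `|` J).
    by move=> [->|/Fgood[]//]; rewrite set0U.
  split; first split=> //.
  - by right; apply: ideal0.
  - move=> a b Fa Fb; have [X FX [Xa Xb]] := mem2 a b Fa Fb.
    by apply: (sub X FX); apply: (idealD (XI X FX)).
  - move=> c a _ Fa; have [X FX [Xa _]] := mem2 a a Fa Fa.
    by apply: (sub X FX); apply: (ideal_mull (XI X FX)).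
  - by move=> a [[X /Fgood[_ XS] Xa]|/JS//]; apply: XS; left.
have meet a : ~ (P `|` J) a -> exists p c, (P `|` J) p /\ S (p + a * c).
  move=> Pa; apply: contrapT => noS.
  have QI := ideal_add_ideal a PI.
  have JQ : J `<=` ideal_add (P `|` J) a.
    by move=> x Jx; apply: sub_ideal_add; right.
  apply: (Pmax (ideal_add (P `|` J) a)).
    split=> [x Px|QP]; first by apply: sub_ideal_add; left.
    by apply: Pa; left; apply: QP; exists 0, 1; rewrite add0r mulr1;
      split=> //; apply: ideal0 PI.
  rewrite /good setUidl //; split=> // x [p [c [Pp ->]]] Sx.
  by apply: noS; exists p, c.
exists (P `|` J); split; [|by move=> x Jx; right|exact: PS].
split; [exact: PI | by move=> P1; apply: PS P1 S1 | move=> a b _ _ Pab].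
apply: contrapT => /not_orP[/meet[p [c [Pp Spc]]] /meet[q [e [Pq Sqe]]]].
apply: (PS _ _ (SM _ _ Spc Sqe)).
have -> : (p + a * c) * (q + b * e) = p * (q + b * e) + (a * c) * q + (a * b) *
  (c * e) by ring.
by do 2?[apply: (idealD PI)]; [apply: (ideal_mulr PI) | apply: (ideal_mull PI)
  | apply: (ideal_mulr PI)].
Qed.

(* The Coquand-Lombardi characterisation of Krull dimension at most one. *)
Lemma krull_dim_le1 J a b : is_ideal setT J -> (krull_dim setT J <= 1)%E ->
  exists p q u c, J (a ^+ p * (b ^+ q * (1 + u * b) + c * a)).
Proof.
move=> JI dimJ; apply: contrapT => noJ.
(* If J misses [S0], three avoidance steps build P0, P1, P2 with a in P1 but not in P0 and b in P2
   but not in P1. Each monoid is shaped so that avoiding it leaves room for the next step. *)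
pose S0 := [set x | exists p q u c, x = a ^+ p * (b ^+ q * (1 + u * b) + c *
  a)].
pose S1 := [set x | exists q u, x = b ^+ q * (1 + u * b)].
have [||x Jx [p [q [u [c xE]]]]|P0 [P0p JP0 P0S]] := @prime_disjoint J S0 JI.
- by exists 0%N, 0%N, 0, 0; ring.
- move=> _ _ [p [q [u [c ->]]]] [p' [q' [u' [c' ->]]]].
  exists (p + p')%N, (q + q')%N, (u + u' + u * u' * b),
    (b ^+ q * (1 + u * b) * c' + c * b ^+ q' * (1 + u' * b) + c * c' * a).
  by rewrite !exprD; ring.
- by apply: noJ; exists p, q, u, c; rewrite -xE.
have P0I : is_ideal setT P0 by case: P0p.
have S1M x y : S1 x -> S1 y -> S1 (x * y).
  move=> [q [u ->]] [q' [u' ->]]; exists (q + q')%N, (u + u' + u * u' * b).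
  by rewrite exprD; ring.
have [||x [y [c [P0y ->]]] [q [u E]]|P1 [P1p P01 P1S]] :=
    @prime_disjoint (ideal_add P0 a) S1 (ideal_add_ideal a P0I).
- by exists 0%N, 0; ring.
- exact: S1M.
- apply: (P0S y P0y); exists 0%N, q, u, (- c).
  by rewrite -E; ring.
have P1I : is_ideal setT P1 by case: P1p.
have [||x [y [c [P1y ->]]] E|P2 [P2p P12 P2S]] :=
    @prime_disjoint (ideal_add P1 b) [set 1] (ideal_add_ideal b P1I).
- by [].
- by move=> _ _ -> ->; rewrite /= mulr1.
- apply: (P1S y P1y); exists 0%N, (- c).
  have -> : y = 1 - b * c by rewrite -E addrK.
  by ring.
have P1a : P1 a.
  by apply: P01; exists 0, 1; rewrite add0r mulr1; split=> //; apply: ideal0.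
have P2b : P2 b.
  by apply: P12; exists 0, 1; rewrite add0r mulr1; split=> //; apply: ideal0.
have : ((2%N%:Z)%:E <= krull_dim setT J)%E.
  apply: le_zsup; exists 2%N => //.
  have P01' : P0 `<=` P1 by move=> x P0x; apply/P01/sub_ideal_add.
  have P12' : P1 `<=` P2 by move=> x P1x; apply/P12/sub_ideal_add.
  exists (fun i => if i is 0 then P0 else if i is 1 then P1 else P2); split.
    move=> [|[|[|//]]] _; split=> // x /JP0 // /P01' //.
    exact: P12'.
  move=> [|[|//]] _; split=> //.
    move=> P10; apply: (P0S a); first exact: P10.
    by exists 1%N, 0%N, 0, 0; ring.
  move=> P21; apply: (P1S b); first exact: P21.
  by exists 1%N, 0; ring.
by move=> /le_trans/(_ dimJ); rewrite lee_fin.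
Qed.

End PrimeAvoidance.

Section DimensionRelations.
Variables (K : fieldType) (n r d : nat) (f : r.-tuple {mpoly K[n]}).
Local Notation R := {mpoly K[n]}.
Hypothesis f_homog : forall i, tnth f i \is d.-homog.

Lemma forms_ideal_homog : homog_ideal (forms_ideal f).
Proof.
have II : is_ideal setT (forms_ideal f) by apply: ideal_gen_ideal.
move=> e _ /forms_idealP[b ->]; rewrite raddf_sum /=;
  apply: ideal_sum => // i _.
rewrite mulrC; have [ed|de] := ltnP e d.
  by rewrite (pihomogM_lt _ (f_homog i)) //; apply: ideal0.
rewrite -(subnKC de) (pihomogM _ _ (f_homog i)).
by apply: (ideal_mulr II); apply: mem_ideal_gen; exists i.
Qed.

Lemma varX_homog (i : 'I_n) p : ('X_i ^+ p : R) \is p.-homog.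
Proof. by rewrite mpolyXn dhomogX /= mdegMn mdeg1 mul1n. Qed.

(** The Krull relation for X_i and X_j made homogeneous: on X_i^(m+1) (R/I), the variable X_j is
    nilpotent modulo X_i. *)
Definition pencil_relation (i j : 'I_n) (m : nat) := exists2 c : R,
  c \is m.-homog & forms_ideal f ('X_i ^+ m.+1 * ('X_j ^+ m.+1 + 'X_i * c)).

Lemma dim_le1_pencil i j : (krull_dim setT (forms_ideal f) <= 1)%E ->
  exists m0, forall m, (m0 <= m)%N -> pencil_relation i j m.
Proof.
have II : is_ideal setT (forms_ideal f) by apply: ideal_gen_ideal.
move=> dimI; have [p [q [u [c Ipq]]]] := krull_dim_le1 'X_i 'X_j II dimI.
have [t [c' hc' E]] : exists t, exists2 c', c' \is t.-homog &
    forms_ideal f ('X_i ^+ p * ('X_j ^+ t.+1 + 'X_i * c')).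
  (* In degree p + q the summand containing u drops out, as it has a form of degree p + q + 1 as a
     factor. For q = 0 the one with c drops out too, leaving X_i^p in I. *)
  have := forms_ideal_homog (p + q) Ipq.
  have -> : 'X_i ^+ p * ('X_j ^+ q * (1 + u * 'X_j) + c * 'X_i) =
    'X_i ^+ p * 'X_j ^+ q + 'X_i ^+ p * 'X_j ^+ q.+1 * u + 'X_i ^+ p.+1 * c :>
      R.
    by rewrite !exprS; ring.
  have h1 : ('X_i ^+ p * 'X_j ^+ q : R) \is (p + q).-homog.
    by apply: dhomogM; apply: varX_homog.
  have h2 : ('X_i ^+ p * 'X_j ^+ q.+1 : R) \is (p + q.+1).-homog.
    by apply: dhomogM; apply: varX_homog.
  rewrite 2!raddfD /= (pihomog_dE h1) (pihomogM_lt _ h2) ?addr0; last by lia.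
  case: q {Ipq h1 h2} => [|q] IE.
    exists 0%N, 0; first exact: dhomog0.
    rewrite (pihomogM_lt _ (varX_homog i p.+1)) in IE; last by lia.
    rewrite addr0 mulr1 in IE.
    by rewrite mulr0 addr0; apply: (ideal_mulr II).
  exists q, (pihomog mdeg q c); first exact: pihomogP.
  rewrite [X in pihomog _ X _](_ : _ = p.+1 + q)%N in IE; last by lia.
  rewrite (pihomogM _ _ (varX_homog i p.+1)) in IE.
  by rewrite mulrDr mulrA -exprSr.
(* Multiplying by powers of X_i and X_j raises both exponents, so that a single m can later serve
   all pairs. *)
exists (p + t)%N => m ptm; exists (c' * 'X_j ^+ (m - t)).
  by rewrite -[m in m.-homog](subnKC (_ : t <= m)%N); [apply: dhomogM => //;
    apply: varX_homog | lia].
have Em : (m.+1 = p + (m.+1 - p))%N by lia.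
rewrite [in X in X * _]Em exprD.
have -> : 'X_j ^+ m.+1 = 'X_j ^+ t.+1 * 'X_j ^+ (m - t) :> R.
  by rewrite -exprD; congr (_ ^+ _); lia.
have := ideal_mull II ('X_i ^+ (m.+1 - p) * 'X_j ^+ (m - t)) E.
by congr (forms_ideal f _); ring.
Qed.

Lemma dim_le1_pencils : (krull_dim setT (forms_ideal f) <= 1)%E ->
  exists m, forall i j, pencil_relation i j m.
Proof.
move=> dimI.
have /choice[g hg] (ij : 'I_n * 'I_n) : exists m0, forall m, (m0 <= m)%N ->
    pencil_relation ij.1 ij.2 m by apply: dim_le1_pencil.
exists (\max_ij g ij)%N => i j; apply: (hg (i, j)).
exact: (leq_bigmax (i, j)).
Qed.

End DimensionRelations.

(** * A linear form generating an ideal of finite colength modulo I *)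

Section LinearParameter.
Variables (K : fieldType) (n r d m : nat) (f : r.-tuple {mpoly K[n]}).
Local Notation R := {mpoly K[n]}.
Variable i : 'I_n.
Hypothesis rel : forall j, pencil_relation f i j m.
Local Notation I := (forms_ideal f).
Let II : is_ideal setT I := ideal_gen_ideal _.

Let B := {ffun 'I_n -> 'I_m.+1}.
Let nu (b : B) : 'X_{1..n} := [multinom if j == i then 0%N else b j | j < n].
Let M0 := (n * m)%N.
(** Padding by X_i gives all [g b] the common degree m + 1 + M0, so the multiplication matrices have
    entries in K. *)
Let g (b : B) : R := 'X_i ^+ (m.+1 + (M0 - mdeg (nu b))) * 'X_[nu b].

Lemma mdeg_nu b : (mdeg (nu b) <= M0)%N.
Proof.
rewrite mdegE /M0 -[n in (n * _)%N]card_ord -sum_nat_const;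
  apply: leq_sum => j _.
by rewrite mnmE; case: ifP => // _; rewrite -ltnS.
Qed.

Let spanned (p : R) := exists a : B -> K,
  I ('X_i ^+ m.+1 * p - 'X_i * \sum_b a b *: g b).

Lemma spannedD p q : spanned p -> spanned q -> spanned (p + q).
Proof.
move=> [a Ia] [b Ib]; exists (fun x => a x + b x).
have := idealD II Ia Ib; congr I.
have -> : \sum_x (a x + b x) *: g x = \sum_x a x *: g x + \sum_x b x *: g x.
  by rewrite -big_split /=; apply: eq_bigr => x _; rewrite scalerDl.
by ring.
Qed.

Lemma spannedZ c p : spanned p -> spanned (c *: p).
Proof.
move=> [a Ia]; exists (fun x => c * a x).
have := ideal_mull II c%:MP Ia; congr I.
have -> : \sum_x (c * a x) *: g x = c *: \sum_x a x *: g x.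
  by rewrite scaler_sumr; apply: eq_bigr => x _; rewrite scalerA.
by rewrite mul_mpolyC scalerBr !scalerAr.
Qed.

Lemma spanned0 : spanned 0.
Proof.
exists (fun=> 0); rewrite big1 => [|b _]; last by rewrite scale0r.
by rewrite !mulr0 subr0; apply: ideal0.
Qed.

Lemma spanned_mod p q : I ('X_i ^+ m.+1 * (p - q)) -> spanned q -> spanned p.
Proof.
move=> Ipq [a Ia]; exists a; have := idealD II Ipq Ia; congr I; by ring.
Qed.

(** An exponent above m at some j other than i is traded, by the pencil relation, for monomials with
    more X_i; the induction is on the missing X_i-degree. When no trade is left, degree M0 + 1
    forces a factor X_i, and the monomial comes from a single g b. *)
Lemma spanned_monomial (al : 'X_{1..n}) : mdeg al = M0.+1 -> spanned 'X_[al].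
Proof.
move Ek: (M0.+1 - al i)%N => k; elim/ltn_ind: k al Ek => k IH al Ek al_deg.
have al_le : (al i <= M0.+1)%N by rewrite -al_deg mdegE (bigD1 i) //= leq_addr.
have [/forallP small|/forallPn[j]] :=
    boolP [forall j, (j != i) ==> (al j < m.+1)%N].
  pose b : B := [ffun j => inord (al j)].
  have nuE : al = (nu b + U_(i) *+ al i)%MM.
    apply/mnmP => j; rewrite mnmDE mulmnE mnm1E mnmE eq_sym.
    have [->|ji] := eqVneq j i; first by rewrite mul1n.
    by rewrite mul0n addn0 ffunE inordK //; apply: (implyP (small j)).
  have degE : (mdeg (nu b) + al i = M0.+1)%N.
    by rewrite -al_deg [in RHS]nuE mdegD mdegMn mdeg1 mul1n.
  exists (fun b' => (b' == b)%:R).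
  rewrite (bigD1 b) //= eqxx scale1r big1 => [|b' /negPf->];
    last exact: scale0r.
  have -> : 'X_i ^+ m.+1 * 'X_[al] = 'X_i * g b.
    rewrite {1}nuE mpolyXD -mpolyXn /g.
    have -> : al i = (M0 - mdeg (nu b)).+1 by have := mdeg_nu b; lia.
    by rewrite exprD !exprS; ring.
  by rewrite addr0 subrr; apply: ideal0.
rewrite negb_imply -leqNgt => /andP[ji alj].
have [c hc Ic] := rel j.
pose be := (al - U_(j) *+ m.+1)%MM.
have alE : al = (U_(j) *+ m.+1 + be)%MM.
  rewrite addmC submK //; apply/mnm_lepP => l; rewrite mulmnE mnm1E.
  by case: eqP => [<-|_]; rewrite ?mul1n.
have be_i : be i = al i by rewrite mnmBE mulmnE mnm1E (negPf ji) mul0n subn0.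
have be_deg : (mdeg be + m = M0)%N.
  by have := congr1 mdeg alE; rewrite mdegD mdegMn mdeg1 al_deg; lia.
have be_le : (al i <= M0)%N.
  by rewrite -be_deg -be_i mdegE (bigD1 i) //= -addnA leq_addr.
apply: (@spanned_mod _ (- ('X_i * c * 'X_[be]))).
  have := ideal_mull II 'X_[be] Ic; congr I.
  by rewrite {1}alE mpolyXD -mpolyXn; ring.
rewrite -scaleN1r; apply: spannedZ.
rewrite [c]mpolyE mulr_sumr mulr_suml big_seq.
elim/big_ind: _ => [|p q|ga /(dhomog_mf hc)/= ga_deg].
- exact: spanned0.
- exact: spannedD.
rewrite -scalerAr -scalerAl; apply: spannedZ; rewrite -!mpolyXD.
apply: (IH (M0.+1 - (U_(i) + ga + be)%MM i)%N) => //.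
  by rewrite !mnmDE mnm1E eqxx be_i; lia.
by rewrite !mdegD mdeg1 ga_deg; lia.
Qed.

Local Notation N := #|{: B}|.
Let gv (b : 'I_N) : R := g (enum_val b).

Lemma multiplication_matrices : exists A : 'I_n -> 'M[K]_N,
  A i = 1%:M /\ forall j b, I ('X_j * gv b -
    'X_i * \sum_b' A j b b' *: gv b').
Proof.
have /choice[a ha] (jb : 'I_n * B) : exists a : B -> K,
    I ('X_(jb.1) * g jb.2 - 'X_i * \sum_b a b *: g b).
  have [a Ia] : spanned ('X_(jb.1) * ('X_i ^+ (M0 - mdeg (nu jb.2)) * 'X_[nu
    jb.2])).
    rewrite mpolyXn -!mpolyXD; apply: spanned_monomial.
    by rewrite !mdegD mdegMn !mdeg1; have := mdeg_nu jb.2; lia.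
  exists a; move: Ia; congr I; congr (_ - _); rewrite /g exprD; ring.
exists (fun j => if j == i then (1%:M : 'M[K]_N) else
   \matrix_(b < N, b' < N) a (j, enum_val b) (enum_val b')).
split=> [|j b]; first by rewrite eqxx.
have [->|ji] := eqVneq j i.
  rewrite (bigD1 b) //= mxE eqxx scale1r big1 => [|b' /negPf bb']; last first.
    by rewrite mxE eq_sym bb' scale0r.
  by rewrite addr0 subrr; apply: ideal0.
have := ha (j, enum_val b) => /=; congr I; congr (_ - _ * _).
rewrite (reindex (@enum_val B predT)) /=; last exact/onW_bij/enum_val_bij.
by apply: eq_bigr => b' _; rewrite mxE.
Qed.

(* Determinant trick: [X_i] times the generators [g b] of [X_i^(m+1) R/I] over
   [K[X_i]] lie in the ideal of a linear form acting invertibly on them. *)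
Lemma linear_parameter : exists A : 'I_n -> 'M[K]_N,
  A i = 1%:M /\ forall u : 'I_n -> K, \sum_j u j *: A j \in unitmx ->
  ideal_add I (\sum_j u j *: 'X_j) ('X_i ^+ (m.+2 + M0)).
Proof.
have [A [Ai AI]] := multiplication_matrices; exists A; split=> // u.
set D := \sum_j _ => uD; set l := \sum_j _.
have Dg b : I (l * gv b - 'X_i * \sum_b' D b b' *: gv b').
  have -> : l * gv b - 'X_i * \sum_b' D b b' *: gv b' =
    \sum_j (u j)%:MP * ('X_j * gv b -
      'X_i * \sum_b' A j b b' *: gv b').
    have -> : \sum_b' D b b' *: gv b' =
       \sum_j u j *: \sum_b' A j b b' *: gv b'.
      under [RHS]eq_bigr do rewrite scaler_sumr.
      rewrite exchange_big /=; apply: eq_bigr => b' _.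
      rewrite summxE scaler_suml; apply: eq_bigr => j _.
      by rewrite mxE scalerA.
    rewrite mulr_suml mulr_sumr -sumrB; apply: eq_bigr => j _.
    by rewrite mul_mpolyC scalerBr -scalerAl -!scalerAr.
  by apply: ideal_sum => // j _; apply: (ideal_mull II).
pose b0 : B := [ffun=> ord0]; pose o := enum_rank b0.
have gb0 : 'X_i ^+ (m.+2 + M0) = 'X_i * g b0.
  have nu0 : nu b0 = 0%MM by apply/mnmP => j; rewrite mnmE mnm0E ffunE if_same.
  by rewrite /g nu0 mdeg0 subn0 mpolyX0 mulr1 -exprS.
(* Row o of the inverse of D, applied to the relations [Dg], isolates X_i g b0, which is the power
   to be reached. *)
have key : I (l * (\sum_b invmx D o b *: gv b) - 'X_i * g b0).
  have := ideal_sum II (index_enum _) (P := xpredT)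
    (fun b _ => ideal_mull II (invmx D o b)%:MP (Dg b)).
  congr I; under eq_bigr do rewrite mul_mpolyC scalerBr [_ *: (l * _)]scalerAr
    [_ *: ('X_i * _)]scalerAr.
  rewrite sumrB -!mulr_sumr; congr (_ - _ * _).
  under eq_bigr do rewrite scaler_sumr.
  rewrite exchange_big /=.
  transitivity (\sum_b' (1%:M : 'M[K]_N) o b' *: gv b').
    apply: eq_bigr => b' _; rewrite -(mulVmx uD) mxE scaler_suml.
    by apply: eq_bigr => b _; rewrite scalerA.
  rewrite (bigD1 o) //= mxE eqxx scale1r {1}/gv enum_rankK big1 ?addr0 // =>
    b' /negPf bo.
  by rewrite mxE eq_sym bo scale0r.
exists (- (l * (\sum_b invmx D o b *: gv b) - 'X_i * g b0)),
  (\sum_b invmx D o b *: gv b).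
by split; [apply: (idealN II) | rewrite gb0; ring].
Qed.

End LinearParameter.

(** * Extension of the ground field and change of coordinates *)

Lemma size_det_pencil (F : fieldType) N (C D : 'M[F]_N) :
  (size (\det (map_mx polyC C + 'X *: map_mx polyC D)) <= N.+1)%N.
Proof.
set M := (_ + _).
apply: (leq_trans (size_sum _ _ _)); apply/bigmax_leqP => s _.
set p := \prod_i _.
have -> : size ((-1) ^+ perm.odd_perm s * p) = size p.
  by case: (perm.odd_perm s); rewrite ?expr1 ?expr0 ?mulN1r ?mul1r ?size_polyN.
apply: (leq_trans (size_poly_prod_leq _ _)); rewrite card_ord.
have sM i j : (size (M i j) <= 2)%N.
  rewrite !mxE (leq_trans (size_polyD _ _)) // geq_max.
  rewrite (leq_trans (size_polyC_leq1 _)) //= (leq_trans (size_polyMleq _ _))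
    //.
  by rewrite size_polyX; have := size_polyC_leq1 (D i j); lia.
have : (\sum_(i < N) size (M i (perm.fun_of_perm s i)) <= N * 2)%N.
  by rewrite -[N in (N * 2)%N]card_ord -sum_nat_const; apply: leq_sum.
rewrite -ltnS => h; apply: leq_trans (leq_sub2r N h) _; lia.
Qed.

Lemma horner_det_pencil (F : fieldType) N (C D : 'M[F]_N) x :
  (\det (map_mx polyC C + 'X *: map_mx polyC D)).[x] = \det (C + x *: D).
Proof.
rewrite -horner_evalE -det_map_mx; congr (\det _); apply/matrixP => i j.
by rewrite !mxE /= /horner_eval hornerD hornerM hornerX !hornerC.
Qed.

(* Coordinates are chosen one at a time, each avoiding the roots of finitely
   many pencils of determinants. *)
Lemma invertible_combination (F : fieldType) n N
    (A : 'I_n.+1 -> 'I_n.+1 -> 'M[F]_N) (s : seq F) :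
  (forall i, A i i = 1%:M) -> uniq s -> (n.+1 * N.+1 < size s)%N ->
  exists u : 'I_n.+1 -> F, u ord0 = 1 /\
    forall i, \sum_j u j *: A i j \in unitmx.
Proof.
move=> A1 us ls.
suff H k : (k < n.+1)%N -> exists u : 'I_n.+1 -> F, [/\ u ord0 = 1,
    forall j : 'I_n.+1, (k < j)%N -> u j = 0 &
    forall i : 'I_n.+1, (i <= k)%N -> \sum_j u j *: A i j \in unitmx].
  have [u [u0 _ uu]] := H n (ltnSn n); exists u; split=> // i.
  by apply: uu; rewrite -ltnS.
elim: k => [|k IH] kn.
  exists (fun j => (j == ord0)%:R); split=> [|j|i]; first by rewrite eqxx.
    by rewrite -(inj_eq val_inj) /= => /gtn_eqF->.
  rewrite leqn0 => /eqP i0; have -> : i = ord0 by apply: val_inj.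
  rewrite (bigD1 ord0) //= scale1r big1 => [|j /negPf->]; last exact: scale0r.
  by rewrite addr0 A1 unitmx1.
have [u [u0 uk uu]] := IH (ltnW kn); pose o := Ordinal kn.
pose D i := \sum_j u j *: A i j.
pose p i := \det (map_mx polyC (D i) + 'X *: map_mx polyC (A i o)).
(* For i <= k the value at 0 is non-zero by induction. For i = k + 1 the slope [A i i] is the
   identity and the determinant is a characteristic polynomial, hence monic. *)
have p_neq0 (i : 'I_n.+1) : (i <= k.+1)%N -> p i != 0.
  rewrite leq_eqVlt => /predU1P[io|ik]; last first.
    have : (p i).[0] != 0 by rewrite horner_det_pencil scale0r addr0 -unitfE
      -unitmxE uu.
    by apply: contraNneq => ->; rewrite horner0.
  have {io}-> : i = o by apply: val_inj.
  rewrite /p A1; have -> : map_mx polyC (D o) + 'X *: map_mx polyC 1%:M =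
    char_poly_mx (- D o).
    by rewrite /char_poly_mx map_mxN opprK map_mx1 scalemx1 addrC.
  exact/monic_neq0/char_poly_monic.
pose P := \prod_(i < n.+1 | (i <= k.+1)%N) p i.
have P0 : P != 0 by apply/prodf_neq0 => i; apply: p_neq0.
have sP : (size P <= size s)%N.
  apply: leq_trans ls; apply: (leq_trans (size_poly_prod_leq _ _)).
  apply: (leq_trans (leq_subr _ _)); rewrite ltnS.
  have -> : (n.+1 * N.+1 = \sum_(i < n.+1) N.+1)%N
    by rewrite sum_nat_const card_ord.
  rewrite [X in (X <= _)%N]big_mkcond /=.
  by apply: leq_sum => i _; case: ifP => // _; apply: size_det_pencil.
have [x xs Px] : exists2 x, x \in s & ~~ root P x.
  apply/hasP; rewrite has_predC; apply: contraTN sP => allP.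
  by rewrite -ltnNge; apply: max_poly_roots.
exists (fun j => u j + (j == o)%:R * x); split=> [|j kj|i ik].
- by rewrite -(inj_eq val_inj) /= mul0r addr0.
- rewrite uk ?add0r; last exact: ltnW.
  by rewrite -(inj_eq val_inj) /= gtn_eqF // mul0r.
have -> : \sum_j (u j + (j == o)%:R * x) *: A i j = D i + x *: A i o.
  under eq_bigr do rewrite scalerDl.
  rewrite big_split /=; congr (_ + _).
  rewrite (bigD1 o) //= eqxx mul1r big1 ?addr0 // => j /negPf->.
  by rewrite mul0r scale0r.
rewrite unitmxE unitfE -horner_det_pencil; apply: contra Px => Dx.
rewrite /root /P horner_prod; apply/eqP.
rewrite (bigD1 i) //=; apply/eqP; rewrite mulf_eq0; apply/orP; left; exact: Dx.
Qed.

Lemma infinite_or_enumerated (T : eqType) (N : nat) :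
  (exists2 s : seq T, uniq s & (N <= size s)%N) \/
  (exists2 s : seq T, uniq s & forall x, x \in s).
Proof.
have [[s us Ns]|noS] := pselect (exists2 s : seq T, uniq s & (N <= size s)%N).
  by left; exists s.
right; pose Q k := `[< exists2 s : seq T, uniq s & size s = k >].
have Q0 : exists k, Q k by exists 0%N; apply/asboolP; exists [::].
have Qle k : Q k -> (k <= N)%N.
  move/asboolP => [s us <-]; rewrite leqNgt; apply/negP => Ns.
  by apply: noS; exists s => //; apply: ltnW.
case: (ex_maxnP Q0 Qle) => k /asboolP[s us sk] kmax; exists s => // x.
apply/negPn/negP => xs; have /kmax : Q k.+1; last by rewrite ltnn.
by apply/asboolP; exists (x :: s); rewrite /= ?xs ?sk.
Qed.

(** When k has fewer than N elements, enough scalars are found among the roots of unity in a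
    splitting field of X^(M+1) - 1. *)
Lemma large_field_extension (k : fieldType) (N : nat) :
  exists (L : fieldExtType k) (s : seq L), uniq s /\ (N <= size s)%N.
Proof.
have [[s us Ns]|[s us sP]] := infinite_or_enumerated k N.
  by exists (k^o : fieldExtType k), s.
have fin_ax : finite_axiom s by move=> x; rewrite count_uniq_mem // sP.
have idxK : cancel (fun x => index x s) (nth 0 s) by move=> x;
  rewrite nth_index.
pose kf : finFieldType := HB.pack (GRing.Field.sort k) k
  (CanIsCountable idxK) (isFinite.Build k fin_ax).
(* Of two consecutive integers one is non-zero in k; this makes the polynomial separable, so its M +
   1 roots are distinct. *)
have [M NM M0] : exists2 M, (N <= M)%N & M.+1%:R != 0 :> kf.
  have [N0|N0] := eqVneq (N.+1%:R : kf) 0; last by exists N.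
  exists N.+1; first exact: leqnSn.
  by rewrite -[N.+2]addn1 natrD N0 add0r oner_neq0.
have p0 : 'X^(M.+1) - 1 != 0 :> {poly kf} by rewrite -size_poly_gt0 size_XnsubC.
have [L [zs pE _]] := FinSplittingFieldFor p0.
exists (L : fieldExtType k), zs.
rewrite rmorphB /= map_polyXn rmorph1 in pE.
split.
  rewrite -separable_prod_XsubC -(eqp_separable pE).
  apply: cyclotomic.separable_Xn_sub_1.
  by rewrite -(rmorph_nat (in_alg L)) fmorph_eq0.
apply: leq_trans NM _.
have := eqp_size pE; rewrite size_prod_XsubC size_XnsubC //.
by move=> [<-].
Qed.

(** Torsion is tested on all forms of large degree because this condition passes through field
    extensions and linear substitutions, whereas powers of the variables depend on the
    coordinates. *)
Definition no_torsion1 (K : fieldType) (n r : nat) (f : r.-tuple {mpoly K[n]})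
  (q : nat) := forall z, koszul_term 1 z -> khom q z -> kdiff f z = 0 ->
  (exists N, forall N' a, (N <= N')%N -> a \is N'.-homog ->
     exists2 w, koszul_term 2 w & kscale a z = kdiff f w) ->
  exists2 v, koszul_term 2 v & z = kdiff f v.

Section KoszulMap.
Variables (K1 K2 : fieldType) (n r : nat).
Variables (f1 : r.-tuple {mpoly K1[n]}) (f2 : r.-tuple {mpoly K2[n]}).
Local Notation R1 := {mpoly K1[n]}.
Local Notation R2 := {mpoly K2[n]}.
Variable h : R1 -> R2.
Hypothesis hD : forall p q, h (p + q) = h p + h q.
Hypothesis hf : forall i p, h (tnth f1 i * p) = tnth f2 i * h p.

Lemma semilinear0 : h 0 = 0.
Proof. by apply: (@addrI _ (h 0)); rewrite -hD !addr0. Qed.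

Lemma semilinearN p : h (- p) = - h p.
Proof. by apply: (@addrI _ (h p)); rewrite -hD !subrr semilinear0. Qed.

Definition kmap (u : koszul K1 n r) : koszul K2 n r := [ffun T => h (u T)].

Lemma kmapE u T : kmap u T = h (u T) :> R2.
Proof. by rewrite ffunE. Qed.

Lemma kmap_d u : kmap (kdiff f1 u) = kdiff f2 (kmap u).
Proof.
apply: kos_ext => T; rewrite kmapE !kdE (big_morph h hD semilinear0).
apply: eq_bigr => j _; rewrite kmapE -!mulrA /ksign -signr_odd -[in
  RHS]signr_odd.
case: odd; rewrite ?expr1 ?expr0 ?mul1r ?hf //.
by rewrite !mulN1r semilinearN hf.
Qed.

Lemma kmap_term p u : koszul_term p u -> koszul_term p (kmap u).
Proof. by move=> hu T hT; rewrite kmapE hu // semilinear0. Qed.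

Lemma kmap0 : kmap 0 = 0.
Proof. by apply: kos_ext => T; rewrite kmapE !kzeroE semilinear0. Qed.

End KoszulMap.

(** * Descent of Koszul homology along a split extension of rings *)

Section Transfer.
Variables (k K : fieldType) (n r : nat) (f : r.-tuple {mpoly k[n]}).
Local Notation R := {mpoly k[n]}.
Local Notation S := {mpoly K[n]}.
Variables (Phi : {rmorphism R -> S}) (I : finType) (c : I -> S) (h : I -> S ->
  R).
Hypothesis hD : forall i p q, h i (p + q) = h i p + h i q.
Hypothesis h_Phi : forall i a p, h i (Phi a * p) = a * h i p.
Hypothesis h_split : forall p, p = \sum_i c i * Phi (h i p).
Hypothesis Phi_homog : forall e a, a \is e.-homog -> Phi a \is e.-homog.
Hypothesis h_homog : forall i e p, p \is e.-homog -> h i p \is e.-homog.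

Definition tuple_image : r.-tuple S := [tuple Phi (tnth f i) | i < r].

Lemma Phi_inj a : Phi a = 0 -> a = 0.
Proof.
move=> Pa; apply: contrapT => /eqP a0; have := oner_neq0 S.
rewrite [1]h_split big1 ?eqxx // => i _.
have /eqP := h_Phi i a 1; rewrite Pa mul0r semilinear0 // eq_sym mulf_eq0.
by rewrite (negPf a0) => /eqP->; rewrite rmorph0 mulr0.
Qed.

Let hf i j p : h i (tnth tuple_image j * p) = tnth f j * h i p.
Proof. by rewrite tnth_mktuple h_Phi. Qed.

Let Phif i j p : c i * Phi (tnth f j * p) = tnth tuple_image j * (c i * Phi p).
Proof. by rewrite tnth_mktuple rmorphM mulrCA. Qed.

Let PhiD i p q : c i * Phi (p + q) = c i * Phi p + c i * Phi q.
Proof. by rewrite rmorphD mulrDr. Qed.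

(** The coordinates [h i] are linear over R and rebuild every element of S, so bounding chains found
    coordinatewise reassemble to one over S. *)
Lemma descend_boundary (z : koszul K n r) :
  (forall i, exists2 v, koszul_term 2 v & kmap (h i) z = kdiff f v) ->
  exists2 v, koszul_term 2 v & z = kdiff tuple_image v.
Proof.
move=> H; have /choice[v hv] i : exists v, koszul_term 2 v /\ kmap (h i) z =
  kdiff f v.
  by have [v tv zv] := H i; exists v.
pose e i := kmap (fun p => c i * Phi p) (r := r).
exists (\sum_i e i (v i)).
  apply: (big_ind (koszul_term 2)) => [|u w|i _];
    [exact: kterm0|exact: ktermD|].
  by apply: kmap_term; [exact: PhiD | exact: (hv i).1].
have kd_sum (F : I -> koszul K n r) :
    kdiff tuple_image (\sum_i F i) = \sum_i kdiff tuple_image (F i).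
  by apply: (big_morph (kdiff tuple_image)); [exact: kdD | exact: kd0].
rewrite kd_sum; apply: kos_ext => T.
transitivity (\sum_i (e i (kdiff f (v i))) T : S); last first.
  rewrite sum_ffunE; apply: eq_bigr => i _.
  by rewrite /e (kmap_d (f2 := tuple_image) (PhiD i) (Phif i)).
rewrite [LHS]h_split; apply: eq_bigr => i _.
by rewrite kmapE -(hv i).2 kmapE.
Qed.

Lemma descend_cycle (z : koszul K n r) i :
  kdiff tuple_image z = 0 -> kdiff f (kmap (h i) z) = 0.
Proof.
by move=> dz; rewrite -(kmap_d (f1 := tuple_image) (hD i) (hf i)) dz kmap0.
Qed.

Lemma no_homology1_transfer e : no_homology1 f e -> no_homology1 tuple_image e.
Proof.
move=> H a z ae tz hz dz; apply: descend_boundary => i; apply: (H a) => //.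
- exact: kmap_term.
- by move=> T; rewrite kmapE; apply: h_homog.
- exact: descend_cycle.
Qed.

Lemma no_torsion1_transfer q : no_torsion1 f q -> no_torsion1 tuple_image q.
Proof.
move=> H z tz hz dz [N hN]; apply: descend_boundary => i; apply: H => //.
- exact: kmap_term.
- by move=> T; rewrite kmapE; apply: h_homog.
- exact: descend_cycle.
exists N => N' a NN' ha; have [w tw zw] := hN N' _ NN' (Phi_homog ha).
exists (kmap (h i) w); first exact: kmap_term.
rewrite -(kmap_d (f1 := tuple_image) (hD i) (hf i)) -zw; apply: kos_ext => T.
by rewrite !(kmapE, kscaleE) h_Phi.
Qed.

Lemma forms_ideal_image a : forms_ideal f a -> forms_ideal tuple_image (Phi a).
Proof.
move=> /forms_idealP[b ->]; apply/forms_idealP; exists (fun i => Phi (b i)).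
by rewrite rmorph_sum; apply: eq_bigr => i _; rewrite rmorphM tnth_mktuple.
Qed.

End Transfer.

Section Substitution.
Variables (K : fieldType) (n : nat).
Local Notation R := {mpoly K[n]}.
Implicit Types (lp lq : n.-tuple R).

Lemma comp_mpolyA (p : R) lp lq :
  (p \mPo lp) \mPo lq = p \mPo [tuple tnth lp i \mPo lq | i < n].
Proof.
rewrite (comp_mpolyEX p lp) [RHS]comp_mpolyEX raddf_sum /=.
apply: eq_bigr => m _; rewrite !comp_mpolyZ !comp_mpolyX rmorph_prod /=.
by congr (_ *: _); apply: eq_bigr => i _; rewrite rmorphXn tnth_mktuple.
Qed.

Lemma comp_mpolyK lp lq (p : R) : (forall i, tnth lp i \mPo lq = 'X_i) ->
  (p \mPo lp) \mPo lq = p.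
Proof.
move=> lpq; rewrite comp_mpolyA -[RHS]comp_mpoly_id; congr (_ \mPo _).
by apply: eq_from_tnth => i; rewrite !tnth_mktuple lpq.
Qed.

Lemma comp_mpoly_homog lp e (p : R) : (forall i, tnth lp i \is 1.-homog) ->
  p \is e.-homog -> p \mPo lp \is e.-homog.
Proof.
move=> hl hp; rewrite comp_mpolyEX big_seq; apply: rpred_sum => m mp.
apply: rpredZ; rewrite comp_mpolyX -(dhomog_mf hp mp) /= mdegE.
elim/big_rec2: _ => [|i a b _ hab]; first exact: dhomog1.
by apply: dhomogM => //; have := dhomogMn (m i) (hl i); rewrite mul1n.
Qed.

End Substitution.

Lemma map_mpoly_homog (K L : fieldType) n (g : {additive K -> L}) e
    (p : {mpoly K[n]}) : p \is e.-homog -> map_mpoly g p \is e.-homog.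
Proof.
move=> /dhomog_mf hp; apply/dhomogP => m; rewrite mcoeff_msupp mcoeff_map_mpoly.
by move=> gp; apply: hp; rewrite mcoeff_msupp; apply: contraNneq gp => ->;
  rewrite raddf0.
Qed.

Section Shear.
Variables (K : fieldType) (n : nat) (u : 'I_n.+1 -> K).
Local Notation R := {mpoly K[n.+1]}.
Hypothesis u0 : u ord0 = 1.

Definition linear_form : R := \sum_j u j *: 'X_j.
(** Since u_0 = 1, the form 2 X_0 - l is X_0 minus the other terms of l; this inverts X_0 -> l in
    every characteristic. *)
Definition shear : n.+1.-tuple R :=
  [tuple if i == ord0 then 'X_ord0 *+ 2 - linear_form else 'X_i | i < n.+1].
Definition unshear : n.+1.-tuple R :=
  [tuple if i == ord0 then linear_form else 'X_i | i < n.+1].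

Lemma linear_formE : linear_form = 'X_ord0 + \sum_(j | j != ord0) u j *: 'X_j.
Proof. by rewrite /linear_form (bigD1 ord0) //= u0 scale1r. Qed.

Lemma comp_linear_form lq : (forall j, j != ord0 -> tnth lq j = 'X_j) ->
  linear_form \mPo lq = tnth lq ord0 + (linear_form - 'X_ord0).
Proof.
move=> lqE; rewrite linear_formE addrAC subrr add0r raddfD /=.
rewrite comp_mpolyXU -tnth_nth raddf_sum; congr (_ + _);
  apply: eq_bigr => j j0 /=.
by rewrite comp_mpolyZ comp_mpolyXU -tnth_nth lqE.
Qed.

Lemma shear_linear_form : linear_form \mPo shear = 'X_ord0.
Proof.
rewrite comp_linear_form => [|j /negPf j0]; rewrite tnth_mktuple ?j0 //= mulr2n.
ring.
Qed.

Lemma shearX i : i != ord0 -> 'X_i \mPo shear = 'X_i.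
Proof. by move=> /negPf i0; rewrite comp_mpolyXU -tnth_nth tnth_mktuple i0. Qed.

Lemma shearK (p : R) : (p \mPo shear) \mPo unshear = p.
Proof.
apply: comp_mpolyK => i; rewrite tnth_mktuple; case: eqP => [->|/eqP/negPf i0].
  rewrite raddfB raddfMn /= comp_linear_form => [|j /negPf j0]; last first.
    by rewrite tnth_mktuple j0.
  by rewrite comp_mpolyXU -tnth_nth tnth_mktuple /= mulr2n; ring.
by rewrite comp_mpolyXU -tnth_nth tnth_mktuple i0.
Qed.

Lemma unshearK (p : R) : (p \mPo unshear) \mPo shear = p.
Proof.
apply: comp_mpolyK => i; rewrite tnth_mktuple; case: eqP => [->|/eqP i0].
  exact: shear_linear_form.
exact: shearX.
Qed.

Lemma varX1_homog (i : 'I_n.+1) : ('X_i : R) \is 1.-homog.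
Proof. by rewrite dhomogX /= mdeg1. Qed.

Lemma linear_form_homog : linear_form \is 1.-homog.
Proof. by apply: rpred_sum => j _; apply: rpredZ; apply: varX1_homog. Qed.

Lemma shear_homog i : tnth shear i \is 1.-homog.
Proof.
rewrite tnth_mktuple; case: ifP => _; last exact: varX1_homog.
by apply: rpredB; [apply: rpredMn; apply: varX1_homog | exact:
  linear_form_homog].
Qed.

Lemma unshear_homog i : tnth unshear i \is 1.-homog.
Proof.
by rewrite tnth_mktuple; case: ifP => _;
  [exact: linear_form_homog | exact: varX1_homog].
Qed.

End Shear.

(** Pigeonhole: a monomial of large degree is divisible by one of the given powers. *)
Lemma torsion_of_powers (K : fieldType) (n r : nat) (f : r.-tuple {mpoly K[n]})
    (z : koszul K n r) :
  (forall i : 'I_n, exists N, exists2 w, koszul_term 2 w &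
     kscale ('X_i ^+ N) z = kdiff f w) ->
  exists N, forall N' a, (N <= N')%N -> a \is N'.-homog ->
     exists2 w, koszul_term 2 w & kscale a z = kdiff f w.
Proof.
move=> /choice[N hN]; pose Nm := (\max_i N i)%N.
exists (n * Nm).+1 => N' a NN' ha.
rewrite [a]mpolyE big_seq.
apply: (big_ind (fun p => exists2 w, koszul_term 2 w & kscale p z = kdiff f w)).
- by exists 0; [exact: kterm0 | rewrite kscale0r kd0].
- move=> p q [v tv zv] [w tw zw]; exists (v + w); first exact: ktermD.
  by rewrite kscaleDl kdD zv zw.
move=> m /(dhomog_mf ha)/= mN'.
have [i mi] : exists i, (Nm <= m i)%N.
  apply/existsP; apply: contraTT NN'; rewrite -mN' => /existsPn small.
  rewrite -ltnNge ltnS mdegE -[n in (n * _)%N]card_ord -sum_nat_const.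
  by apply: leq_sum => i _; have := small i; rewrite -ltnNge => /ltnW.
have [w tw zw] := hN i.
have Ni : (U_(i) *+ N i <= m)%MM.
  apply/mnm_lepP => j; rewrite mulmnE mnm1E; case: eqP => [<-|//].
  by rewrite mul1n (leq_trans _ mi) // leq_bigmax.
exists (kscale (a@_m *: 'X_[m - U_(i) *+ N i]) w); first exact: ktermZ.
rewrite kd_scale -zw kscaleA; congr (kscale _ _).
by rewrite -scalerAl mpolyXn -mpolyXD submK.
Qed.

Section ShearedExtension.
Variables (k : fieldType) (L : fieldExtType k) (n : nat) (u : 'I_n.+1 -> L).
Hypothesis u0 : u ord0 = 1.
Local Notation R := {mpoly k[n.+1]}.
Local Notation S := {mpoly L[n.+1]}.
Let b := vbasis {:L}.

Definition ext_mpoly : {rmorphism R -> S} := map_mpoly (in_alg L).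
Definition ext_coord (i : 'I_(\dim {:L})) (p : S) : R := map_mpoly (coord b i)
  p.

Lemma ext_coordM i a p : ext_coord i (ext_mpoly a * p) = a * ext_coord i p.
Proof.
apply/mpolyP => m; rewrite mcoeff_map_mpoly !mcoeffM raddf_sum /=.
apply: eq_bigr => m' _.
by rewrite !mcoeff_map_mpoly /= mulr_algl linearZ.
Qed.

Lemma ext_coord_split p : p = \sum_(i < \dim {:L}) (b`_i)%:MP * ext_mpoly
  (ext_coord i p).
Proof.
apply/mpolyP => m; rewrite raddf_sum /= [LHS](coord_vbasis (memvf _)).
apply: eq_bigr => i _.
by rewrite mcoeffCM !mcoeff_map_mpoly /= mulr_algr.
Qed.

Definition sheared_ext : {rmorphism R -> S} :=
  (comp_mpoly (shear u) \o ext_mpoly)%FUN.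
Definition sheared_coord (i : 'I_(\dim {:L})) (p : S) : R :=
  ext_coord i (p \mPo unshear u).

Lemma sheared_coordD i p q :
  sheared_coord i (p + q) = sheared_coord i p + sheared_coord i q.
Proof. by rewrite /sheared_coord /ext_coord !raddfD. Qed.

Lemma sheared_coordM i a p :
  sheared_coord i (sheared_ext a * p) = a * sheared_coord i p.
Proof. by rewrite /sheared_coord rmorphM /= shearK // ext_coordM. Qed.

Lemma sheared_coord_split p :
  p = \sum_(i < \dim {:L}) (b`_i)%:MP * sheared_ext (sheared_coord i p).
Proof.
rewrite -[LHS](unshearK u0) [X in X \mPo _]ext_coord_split rmorph_sum /=.
by apply: eq_bigr => i _; rewrite rmorphM /= comp_mpolyC.
Qed.

Lemma sheared_ext_homog e a : a \is e.-homog -> sheared_ext a \is e.-homog.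
Proof.
by move=> ha; apply: comp_mpoly_homog (shear_homog u) _; apply: map_mpoly_homog.
Qed.

Lemma sheared_coord_homog i e p : p \is e.-homog -> sheared_coord i p \is
  e.-homog.
Proof.
move=> hp; apply: map_mpoly_homog.
exact: comp_mpoly_homog (unshear_homog u) hp.
Qed.

End ShearedExtension.

Lemma pencil_relation_ext (k : fieldType) (L : fieldExtType k) (n r m : nat)
    (f : r.-tuple {mpoly k[n.+1]}) i j : pencil_relation f i j m ->
  pencil_relation (tuple_image f (ext_mpoly L n)) i j m.
Proof.
move=> [c hc Ic]; exists (ext_mpoly L n c); first exact: map_mpoly_homog.
have := forms_ideal_image (ext_mpoly L n) Ic.
by rewrite rmorphM rmorphD rmorphM !rmorphXn /= !map_mpolyX.
Qed.

Section Assembly.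
Variables (k : fieldType) (m d : nat) (f : m.+3.-tuple {mpoly k[m.+2]}).
Hypothesis f_homog : forall i, tnth f i \is d.-homog.
Hypothesis f_neq0 : forall i, tnth f i != 0.
Hypothesis d_gt0 : (0 < d)%N.

Lemma low_degree_class (e := (m * d.-1)./2) :
  (krull_dim setT (forms_ideal f) <= 1)%E ->
  no_homology1 f e -> no_torsion1 f (m.+2 * d - (e + d.-1 + m.+2)) -> False.
Proof.
move=> /(dim_le1_pencils f_homog)[l rel] H1 H0.
pose B := {ffun 'I_m.+2 -> 'I_l.+1}.
have [L [s [us ls]]] := large_field_extension k (m.+2 * #|{: B}|.+1).+1.
pose fL := tuple_image f (ext_mpoly L m.+1).
have /choice[A hA] i : exists A : 'I_m.+2 -> 'M[L]_#|{: B}|,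
    A i = 1%:M /\ forall u : 'I_m.+2 -> L, \sum_j u j *: A j \in unitmx ->
    ideal_add (forms_ideal fL) (\sum_j u j *: 'X_j) ('X_i ^+ (l.+2 + m.+2 * l)).
  by apply: linear_parameter => j; apply: pencil_relation_ext.
have [u [u0 uA]] := invertible_combination (fun i => (hA i).1) us ls.
pose Phi := sheared_ext u; pose g := tuple_image f Phi.
have g_homog i : tnth g i \is d.-homog.
  by rewrite tnth_mktuple; apply: sheared_ext_homog.
have hD := sheared_coordD u; have hM := sheared_coordM u0.
have hS := sheared_coord_split u0.
have g_neq0 i : tnth g i != 0.
  rewrite tnth_mktuple; apply: contraNneq (f_neq0 i) => /(Phi_inj hD hM hS)->.
  exact: eqxx.
have G1 : no_homology1 g e.
  exact: (no_homology1_transfer hD hM hS (@sheared_coord_homog _ _ _ u) H1).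
have G0 := no_torsion1_transfer hD hM hS (@sheared_ext_homog _ _ _ u)
  (@sheared_coord_homog _ _ _ u) H0.
have X0 : 'X_ord0 != 0 :> {mpoly L[m.+2]}.
  by rewrite -msupp_eq0 msuppX.
have [x [hx xI Xx]] := annihilated_by_linear_form g_homog d_gt0 g_neq0 G1
  (varX1_homog L ord0) X0.
(* The shear carries the linear form given by u to X_0 and fixes the other variables, so it
   transports the relations of [linear_parameter]. *)
have XM i : ideal_add (forms_ideal g) 'X_ord0 ('X_i ^+ (l.+2 + m.+2 * l)).
  have [->|i0] := eqVneq i ord0.
    exists 0, ('X_ord0 ^+ (l.+1 + m.+2 * l)); rewrite add0r -exprS; split=> //.
    exact: (ideal0 (ideal_gen_ideal (range (tnth g)))).
  have [a [b [/forms_idealP[c ->] E]]] := (hA i).2 u (uA i).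
  exists ((\sum_j c j * tnth fL j) \mPo shear u), (b \mPo shear u); split.
    apply/forms_idealP; exists (fun j => c j \mPo shear u).
    rewrite rmorph_sum; apply: eq_bigr => j _.
    by rewrite rmorphM /= !tnth_mktuple.
  rewrite -(shear_linear_form u0) -rmorphM -rmorphD -[X in _ = X]/(_ \mPo _) -E.
  by rewrite rmorphXn /= shearX.
have en : (e + d.-1 + m.+2 <= m.+2 * d)%N.
  rewrite /e; case: (d) d_gt0 => // d' _ /=; rewrite mulnS mulSn.
  by have := half_leq (leqnn (m * d')); lia.
have [z [tz hz dz tors nz]] := dual_torsion_class g_homog hx xI
  (eq_ind _ (forms_ideal g) Xx _ (mulrC _ _)) XM en.
have [v tv zv] := G0 z tz hz dz (torsion_of_powers tors).
exact: nz v tv zv.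
Qed.

End Assembly.

(** * The threshold degree *)

Section Interface.
Variables (k : fieldType) (n r d : nat) (f : r.-tuple {mpoly k[n]}).
Local Notation R := {mpoly k[n]}.

(** The shift in K_1 = R(-d): [khom] counts the degree of coefficients, which is d less than the
    internal degree. *)
Lemma khom_koszul_deg a (z : koszul k n r) :
  koszul_term 1 z -> khom a z -> koszul_deg d 1 (a + d)%N%:Z z.
Proof.
move=> tz hz; split=> // T; rewrite mul1n PoszD addrK; exact: hz.
Qed.

Lemma indeg_koszul_le a z : koszul_term 1 z -> khom a z -> kdiff f z = 0 ->
  (forall v, koszul_term 2 v -> z <> kdiff f v) ->
  (indeg (koszul_homology d f 1) <= (a + d)%N%:Z%:E)%E.
Proof.
rewrite kdiff.unlock => tz hz dz nz; apply: zinf_le; exists z; split=> //.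
  exact: khom_koszul_deg.
by move=> [v tv zv]; apply: (nz v).
Qed.

Lemma ideal_pow_low_degree t (p : R) mm : ideal_pow max_ideal t p ->
  (mdeg mm < t)%N -> p@_mm = 0.
Proof.
have monI (t' : nat) :
    is_ideal setT [set p : R | forall m, (mdeg m < t')%N -> p@_m = 0].
  split=> //= [m _|x y hx hy m mt|a x _ hx m mt]; first by rewrite mcoeff0.
    by rewrite mcoeffD hx ?hy ?addr0.
  rewrite mcoeffM big1 // => -[m1 m2] /= /eqP mE.
  rewrite hx ?mulr0 //; have := congr1 mdeg mE; rewrite mdegD.
  by move: mt; lia.
have hmax (q : R) : max_ideal q -> forall m, (mdeg m < 1)%N -> q@_m = 0.
  apply: (ideal_gen_min (monI 1%N)) => _ [i _ <-] m /=.
  rewrite ltnS leqn0 mcoeffX => /eqP m0.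
  by case: eqP => // E; move: m0; rewrite -E mdeg1.
move=> Ip; apply: (ideal_gen_min (monI t) _ Ip) => {mm p Ip} _ [g hg ->] /=.
have {}hg i := hmax _ (hg i).
elim: t g hg => [//|t IH] g hg m mt.
rewrite big_ord_recl mcoeffM big1 // => -[m1 m2] /= /eqP mE.
have [m10|m10] := posnP (mdeg m1); first by rewrite hg ?mul0r // m10.
have m2t : (mdeg m2 < t)%N.
  by have := congr1 mdeg mE; rewrite mdegD; move: mt m10; lia.
by rewrite (IH (fun i => g (lift ord0 i)) (fun i => hg _) _ m2t) mulr0.
Qed.

Lemma ideal_pow_torsion (z : koszul k n r) :
  (exists N, forall N' a, (N <= N')%N -> a \is N'.-homog ->
     exists2 w, koszul_term 2 w & kscale a z = kdiff f w) ->
  exists t, forall a, ideal_pow max_ideal t a ->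
     exists2 w, koszul_term 2 w & kscale a z = kdiff f w.
Proof.
move=> [N hN]; exists N => a Ia; rewrite [a]mpolyE big_seq.
apply: (big_ind (fun p => exists2 w, koszul_term 2 w & kscale p z = kdiff f w)).
- by exists 0; [exact: kterm0 | rewrite kscale0r kd0].
- move=> p q [v tv zv] [w tw zw]; exists (v + w); first exact: ktermD.
  by rewrite kscaleDl kdD zv zw.
move=> m ma; apply: (hN (mdeg m)); last by apply: rpredZ; rewrite dhomogX.
rewrite leqNgt; apply: contraL ma => /(ideal_pow_low_degree Ia) am.
by rewrite mcoeff_msupp am eqxx.
Qed.

Lemma indeg_torsion_le a z : koszul_term 1 z -> khom a z -> kdiff f z = 0 ->
  (exists N, forall N' p, (N <= N')%N -> p \is N'.-homog ->
     exists2 w, koszul_term 2 w & kscale p z = kdiff f w) ->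
  (forall v, koszul_term 2 v -> z <> kdiff f v) ->
  (indeg (local_coh0 max_ideal (koszul_homology d f 1)) <= (a + d)%N%:Z%:E)%E.
Proof.
move=> tz hz dz /ideal_pow_torsion[t ht] nz; apply: zinf_le; exists z; split.
- exact: khom_koszul_deg.
- split; first by rewrite kdiff.unlock in dz.
  exists t => p /ht[w tw]; rewrite kdiff.unlock kscale.unlock => zw.
  by exists w.
- by move=> [v tv zv]; apply: (nz v) => //; rewrite kdiff.unlock.
Qed.

End Interface.

Theorem proposition6 (k : fieldType) (n d : nat)
    (f : n.+1.-tuple {mpoly k[n]})
    (n_ge3 : (3 <= n)%N) (d_ge2 : (2 <= d)%N)
    (f_homog : forall i, tnth f i \is d.-homog)
    (f_indep : forall c : 'I_n.+1 -> k,
       \sum_(i < n.+1) c i *: tnth f i = 0 -> forall i, c i = 0)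
    (f_dim : krull_dim (subalgebra_gen f) [set 0]
             = krull_dim [set: {mpoly k[n]}] [set 0])
    (I_dim : (krull_dim setT (forms_ideal f) <= 1)%E)
    (I_nu : forall P : set {mpoly k[n]},
       is_prime setT P -> forms_ideal f `<=` P ->
       (nu (loc P setT) (loc P (forms_ideal f))
        <= krull_dim (loc P setT) [set 0%R] + 1)%E) :
  ((((n%:Z - 2) * (d%:Z - 1) - 1)%R %/ 2)%Z%:E <= mu0 d f)%E.
Proof.
case: n => [|[|m]] // in f n_ge3 f_homog f_indep f_dim I_dim I_nu *.
have d_gt0 : (0 < d)%N by apply: ltnW.
have f_neq0 i : tnth f i != 0.
  apply/eqP => fi0; have /(_ _ i) := f_indep (fun j => (j == i)%:R).
  rewrite eqxx => /(_ _)/eqP; rewrite oner_eq0 => h; apply/notF/h.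
  rewrite (bigD1 i) //= fi0 scaler0 big1 ?addr0 // => j /negPf->.
  exact: scale0r.
pose e := (m * d.-1)./2; pose q := (m.+2 * d - (e + d.-1 + m.+2))%N.
pose T : int := (m.+2%:Z - 1) * (d%:Z - 1).
pose F : int := (((m.+2%:Z - 2) * (d%:Z - 1) - 1)%R %/ 2)%Z.
have [D DE] : exists D, (m * d.-1)%N = D by exists (m * d.-1)%N.
have DZ : (m.+2%:Z - 2) * (d%:Z - 1) = D%:Z.
  by rewrite -DE PoszM; congr (_ * _); lia.
have TE : T = D%:Z + (d%:Z - 1).
  by rewrite -DZ /T (_ : m.+2%:Z - 1 = m.+2%:Z - 2 + 1) ?mulrDl ?mul1r //; lia.
have eE : e = D./2 by rewrite /e DE.
have qE : q = (D + d.-1 - e)%N.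
  rewrite /q -DE; case: (d) d_gt0 => // d' _ /=; rewrite mulnS mulSn mulSn; lia.
suff H : (mine (indeg (koszul_homology d f 1))
   (indeg (local_coh0 max_ideal (koszul_homology d f 1)) - d%:Z%:E) <= (T -
     F)%:E)%E.
  rewrite /mu0 -/T -/F; move: H; case: mine => [y| |] //.
  - by rewrite lee_fin => yT; change (F%:E <= (T - y)%:E)%E; rewrite lee_fin;
    lia.
  - by move=> _ /=; rewrite leey.
have FE : F = ((D%:Z - 1)%R %/ 2)%Z by rewrite /F DZ.
(* The two roundings satisfy e + F = D - 1, so T - F equals e + d; and q <= e + d amounts to D - 1
   <= 2e. *)
have TF1 : (e + d)%N%:Z <= T - F by rewrite TE FE eE; lia.
have TF2 : q%:Z <= T - F by rewrite TE FE qE eE; lia.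
(* A class of H_1 of coefficient degree at most e bounds the first term of the minimum. Failing
   that, a torsion class of coefficient degree q bounds the second, where subtracting d undoes the
   Koszul shift. [low_degree_class] excludes that both are missing. *)
have [H1|nH1] := pselect (no_homology1 f e); last first.
  have [a [z [ae tz hz dz nz]]] : exists a z, [/\ (a <= e)%N, koszul_term 1 z,
      khom a z, kdiff f z = 0 & forall v, koszul_term 2 v -> z <> kdiff f v].
    apply: contrapT => noz; apply: nH1 => a z ae tz hz dz.
    apply: contrapT => nv; apply: noz; exists a, z; split=> // v tv zv.
    by apply: nv; exists v.
  rewrite ge_min; apply/orP; left.
  apply: le_trans (indeg_koszul_le d tz hz dz nz) _.
  by rewrite lee_fin (le_trans _ TF1) // lez_nat leq_add2r.
have [H0|nH0] := pselect (no_torsion1 f q); last first.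
  have [z [tz hz dz tors nz]] : exists z, [/\ koszul_term 1 z, khom q z,
      kdiff f z = 0, (exists N, forall N' p, (N <= N')%N -> p \is N'.-homog ->
        exists2 w, koszul_term 2 w & kscale p z = kdiff f w) &
      forall v, koszul_term 2 v -> z <> kdiff f v].
    apply: contrapT => noz; apply: nH0 => z tz hz dz tors.
    apply: contrapT => nv; apply: noz; exists z; split=> // v tv zv.
    by apply: nv; exists v.
  rewrite ge_min; apply/orP; right.
  have := indeg_torsion_le d tz hz dz tors nz.
  case: (indeg _) => [y| |].
  - rewrite lee_fin => yq; change ((y - d%:Z)%:E <= (T - F)%:E)%E.
    by rewrite lee_fin; lia.
  - by rewrite leye_eq.
  - by move=> _ /=; rewrite leNye.
by case: (low_degree_class f_homog f_neq0 d_gt0 I_dim H1 H0).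
Qed.
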